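(* Let $n\ge 2$, let $R$ be a commutative ring and $u\in R^\times$. Let $(W,S)$ be the Coxeter system of type $A_{n-1}$, with $S=\{s_1,\dots,s_{n-1}\}$ and $W\cong S_n$; let $(U,T)=(W,S)$, let $\phi=\mathrm{id}_W$, and let $e\colon S\to\Sigma(\Phi_W)$, $e_{s}=\langle s\rangle=\{\pm\alpha_s\}$. Then the algebra $\mathcal{E}^{(W,S)}(R[\Sigma(\Phi_U)_{[e]}],\rho_\phi,\hat e)$, where $\hat e_s=1+(u-1)e_s$, coincides with the algebra of braids and ties $\mathcal E_n$: there is an isomorphism of $R$-algebras between them matching $g_{s_i}$ with $g_i$ and $e_{s_i}$ with $e_i$ for $i=1,\dots,n-1$.
   Context: The algebra of braids and ties $\mathcal E_n$ is the $R$-algebra generated by $g_1,\dots,g_{n-1},e_1,\dots,e_{n-1}$ subject to the relations $g_ig_j=g_jg_i$ if $|i-j|>1$; $g_ig_jg_i=g_jg_ig_j$ if $|i-j|=1$; $g_i^2=1+(u-1)e_i(1-g_i)$; $g_ie_j=e_jg_i$ if $|i-j|\ne 1$; $g_jg_ie_j=e_ig_jg_i$ if $|i-j|=1$; $e_ie_j=e_je_i$; $e_i^2=e_i$; $e_ie_jg_j=e_ig_je_i=g_je_ie_j$ if $|i-j|=1$. Root subsystems. $\Phi_W$ is the root system of $(W,S)$ (type $A_{n-1}$), with simple roots $\alpha_s$, $s\in S$. A root subsystem is a (possibly empty) subset $\Psi\subseteq\Phi_W$ stable under the reflections in all of its elements; $\Sigma(\Phi_W)$ is the set of root subsystems, a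 commutative monoid under $\Psi_1\cdot\Psi_2=$ the root subsystem generated by $\Psi_1\cup\Psi_2$, with the $W$-action $\rho_\phi$ induced by the action of $W$ on $\Phi_W$ (here $\phi$ is the identity). $\Sigma(\Phi_U)_{[e]}$ is the submonoid generated by all $w.e_s$, $w\in W$, $s\in S$, and $R[\Sigma(\Phi_U)_{[e]}]$ is its monoid algebra over $R$, with the $R$-linearly extended $W$-action. Marin ring. Let $B_W$ be the Artin braid group of $(W,S)$, with generators $g_s$ ($s\in S$) and the braid relations of $(W,S)$, and $\pi\colon B_W\to W$ the canonical projection. For a commutative $R$-algebra $A$ with an action $\rho$ of $W$ by $R$-algebra automorphisms and a map $a\colon S\to A^\times$ such that $w.a_{s}=a_{s'}$ whenever $wsw^{-1}=s'$ with $s,s'\in S$, $w\in W$, the ring $\mathcal{E}^{(W,S)}(A,\rho,a)$ is the quotient of $A\rtimes R[B_W]$ (generated by $A$ and $B_W$ with $gc=(\pi(g).c)g$ for $g\in B_W$, $c\in A$) by the two-sided ideal generated by $g_s^2-a_s-(1-a_s)g_s$, $s\in S$. *)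

(* Defs.v *)
From HB Require Import structures.
From mathcomp Require Import all_boot all_order all_algebra all_fingroup.
From mathcomp Require Import generic_quotient finmap boolp classical_sets.
From mathcomp Require Import zify ring.
From mathcomp.multinomials Require Import (canonicals) monalg.

Set Implicit Arguments.
Unset Strict Implicit.
Unset Printing Implicit Defensive.

Import GRing.Theory.

Local Open Scope ring_scope.
Local Open Scope quotient_scope.

(* [algType R] forces 1 != 0. Over an arbitrary commutative ring, possibly
   zero, an R-algebra is a ring with a central structure morphism from R. *)

HB.mixin Record hasScalars (R : comPzRingType) A of GRing.PzRing A := {
  rscalar : {rmorphism R -> A};
  rscalar_central : forall (r : R) (x : A), rscalar r * x = x * rscalar r
}.

#[short(type="pzAlgebraType")]
HB.structure Definition PzAlgebra (R : comPzRingType) :=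
  {A of GRing.PzRing A & hasScalars R A}.

#[short(type="comPzAlgebraType")]
HB.structure Definition ComPzAlgebra (R : comPzRingType) :=
  {A of GRing.ComPzRing A & PzAlgebra R A}.

Definition alg_morphism (R : comPzRingType) (A B : pzAlgebraType R)
    (f : {rmorphism A -> B}) : Prop :=
  forall r : R, f (rscalar r) = rscalar r.

HB.instance Definition _ (R : comPzRingType) := GRing.ComPzRing.on R^o.

Fact regular_scalar_central (R : comPzRingType) (r : R) (x : R^o) :
  (idfun : {rmorphism R -> R^o}) r * x = x * (idfun : {rmorphism R -> R^o}) r.
Proof. exact: mulrC. Qed.

HB.instance Definition _ (R : comPzRingType) :=
  hasScalars.Build R R^o (@regular_scalar_central R).

Section AlgebraQuotient.
Variables (R : comPzRingType) (A : pzAlgebraType R).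
Implicit Types (X : set A) (x y z : A).

Inductive gen_ideal X : set A :=
| gen_ideal_in x : X x -> gen_ideal X x
| gen_ideal0 : gen_ideal X 0
| gen_idealD x y : gen_ideal X x -> gen_ideal X y -> gen_ideal X (x + y)
| gen_idealMl x y : gen_ideal X y -> gen_ideal X (x * y)
| gen_idealMr x y : gen_ideal X x -> gen_ideal X (x * y).

Variable X : set A.
Local Notation I := (gen_ideal X).

Lemma gen_idealN x : I x -> I (- x).
Proof. by move=> Ix; rewrite -mulN1r; apply: gen_idealMl. Qed.

Lemma gen_idealB x y : I x -> I y -> I (x - y).
Proof. by move=> Ix Iy; apply: gen_idealD => //; apply: gen_idealN. Qed.

Definition ideal_cong : rel A := fun x y => `[< I (x - y) >].

Fact ideal_cong_equiv : equiv_class_of ideal_cong.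
Proof.
split=> [x|x y|y x z].
- by apply/asboolP; rewrite subrr; apply: gen_ideal0.
- by apply/asboolP/asboolP => /gen_idealN; rewrite opprB.
- move=> /asboolP Ixy /asboolP Iyz; apply/asboolP.
  by rewrite -(subrK y x) -addrA; apply: gen_idealD.
Qed.

Canonical ideal_cong_equivRel := EquivRelPack ideal_cong_equiv.

Definition quot_alg : Type := {eq_quot ideal_cong}.
HB.instance Definition _ := Choice.on quot_alg.
HB.instance Definition _ := EqQuotient.on quot_alg.

Definition to_quot (x : A) : quot_alg := \pi_quot_alg x.

Lemma to_quotP x y : to_quot x = to_quot y <-> I (x - y).
Proof.
by split=> [/eqmodP/asboolP //|Ixy]; apply/eqmodP/asboolP.
Qed.

Lemma to_quotK (a : quot_alg) : to_quot (repr a) = a.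
Proof. exact: reprK. Qed.

Lemma repr_to_quot x : I (repr (to_quot x) - x).
Proof. by apply/to_quotP; rewrite to_quotK. Qed.

Definition quot_zero : quot_alg := to_quot 0.
Definition quot_one : quot_alg := to_quot 1.
Definition quot_opp (a : quot_alg) : quot_alg := to_quot (- repr a).
Definition quot_add (a b : quot_alg) : quot_alg := to_quot (repr a + repr b).
Definition quot_mul (a b : quot_alg) : quot_alg := to_quot (repr a * repr b).
Lemma quot_addE x y : quot_add (to_quot x) (to_quot y) = to_quot (x + y).
Proof.
by apply/to_quotP; rewrite opprD addrACA; apply: gen_idealD;
   apply: repr_to_quot.
Qed.

Lemma quot_oppE x : quot_opp (to_quot x) = to_quot (- x).
Proof.
by apply/to_quotP; rewrite -opprD; apply: gen_idealN; apply: repr_to_quot.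
Qed.

Lemma quot_mulE x y : quot_mul (to_quot x) (to_quot y) = to_quot (x * y).
Proof.
apply/to_quotP; set x' := repr _; set y' := repr _.
have -> : x' * y' - x * y = (x' - x) * y' + x * (y' - y).
  by rewrite mulrBl mulrBr addrA subrK.
by apply: gen_idealD; [apply: gen_idealMr|apply: gen_idealMl];
   apply: repr_to_quot.
Qed.

Lemma quot_ind (P : quot_alg -> Prop) :
  (forall x, P (to_quot x)) -> forall a, P a.
Proof. by move=> Px a; rewrite -[a]to_quotK. Qed.

Fact quot_addA : associative quot_add.
Proof.
by elim/quot_ind=> x; elim/quot_ind=> y; elim/quot_ind=> z;
   rewrite !quot_addE addrA.
Qed.
Fact quot_addC : commutative quot_add.
Proof.
by elim/quot_ind=> x; elim/quot_ind=> y; rewrite !quot_addE addrC.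
Qed.
Fact quot_add0 : left_id quot_zero quot_add.
Proof. by elim/quot_ind=> x; rewrite quot_addE add0r. Qed.
Fact quot_addN : left_inverse quot_zero quot_opp quot_add.
Proof. by elim/quot_ind=> x; rewrite quot_oppE quot_addE addNr. Qed.

HB.instance Definition _ :=
  GRing.isZmodule.Build quot_alg quot_addA quot_addC quot_add0 quot_addN.

Fact quot_mulA : associative quot_mul.
Proof.
by elim/quot_ind=> x; elim/quot_ind=> y; elim/quot_ind=> z;
   rewrite !quot_mulE mulrA.
Qed.
Fact quot_mul1l : left_id quot_one quot_mul.
Proof. by elim/quot_ind=> x; rewrite quot_mulE mul1r. Qed.
Fact quot_mul1r : right_id quot_one quot_mul.
Proof. by elim/quot_ind=> x; rewrite quot_mulE mulr1. Qed.
Fact quot_mulDl : left_distributive quot_mul quot_add.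
Proof.
by elim/quot_ind=> x; elim/quot_ind=> y; elim/quot_ind=> z;
   rewrite !(quot_mulE, quot_addE) mulrDl.
Qed.
Fact quot_mulDr : right_distributive quot_mul quot_add.
Proof.
by elim/quot_ind=> x; elim/quot_ind=> y; elim/quot_ind=> z;
   rewrite !(quot_mulE, quot_addE) mulrDr.
Qed.

HB.instance Definition _ := GRing.Zmodule_isPzRing.Build quot_alg
  quot_mulA quot_mul1l quot_mul1r quot_mulDl quot_mulDr.

Fact to_quot_is_nmod_morphism : nmod_morphism to_quot.
Proof. by split=> // x y; rewrite -quot_addE. Qed.
Fact to_quot_is_monoid_morphism : monoid_morphism to_quot.
Proof. by split=> // x y; rewrite -quot_mulE. Qed.

HB.instance Definition _ :=
  GRing.isNmodMorphism.Build A quot_alg to_quot to_quot_is_nmod_morphism.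
HB.instance Definition _ :=
  GRing.isMonoidMorphism.Build A quot_alg to_quot to_quot_is_monoid_morphism.

Fact quot_scalar_central (r : R) (a : quot_alg) :
  (to_quot \o rscalar : {rmorphism R -> quot_alg}) r * a =
  a * (to_quot \o rscalar : {rmorphism R -> quot_alg}) r.
Proof. by elim/quot_ind: a => x; rewrite /= -!rmorphM /= rscalar_central. Qed.

HB.instance Definition _ := hasScalars.Build R quot_alg quot_scalar_central.

End AlgebraQuotient.

Record alg_action (M : monoidType) (R : comPzRingType) (A : pzAlgebraType R) :=
  AlgAction {
    alg_act :> M -> {rmorphism A -> A};
    alg_act1 : forall x, alg_act 1%g x = x;
    alg_actM : forall g h x, alg_act (g * h)%g x = alg_act g (alg_act h x);
    alg_act_scalar : forall g r, alg_act g (rscalar r) = rscalar r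
  }.

(* The skew monoid ring of a monoid M acting on an algebra A: finitely
   supported functions M -> A, written as sums of terms c.k (c in A, k in M),
   with (c.k)(d.l) = (c * act k d).(k * l). *)
Definition skew_alg (M : monoidType) (R : comPzRingType) (A : pzAlgebraType R)
    (act : alg_action M A) : Type := monalg.malg M A.

HB.instance Definition _ (M : monoidType) (R : comPzRingType)
    (A : pzAlgebraType R) (act : alg_action M A) :=
  GRing.Zmodule.copy (skew_alg act) (monalg.malg M A).

HB.lock Definition skew_term (M : monoidType) (R : comPzRingType)
    (A : pzAlgebraType R) (act : alg_action M A) (c : A) (k : M) :
  skew_alg act := monalg.mkmalgU k c.

HB.lock Definition skew_mul (M : monoidType) (R : comPzRingType)
    (A : pzAlgebraType R) (act : alg_action M A) (f g : skew_alg act) :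
  skew_alg act :=
  \sum_(k <- monalg.msupp f) \sum_(l <- monalg.msupp g)
    skew_term act (monalg.mcoeff k f * act k (monalg.mcoeff l g)) (k * l)%g.

Section SkewMonoidAlgebra.
Variables (M : monoidType) (R : comPzRingType) (A : pzAlgebraType R).
Variable act : alg_action M A.

Local Notation skew_alg := (skew_alg act).
Local Notation skew_term := (skew_term act).
Local Notation skew_mul := (@skew_mul M R A act).

Implicit Types (f g : skew_alg) (k l : M) (c d : A).

Local Notation msupp := monalg.msupp.
Local Notation "f @_ k" := (monalg.mcoeff k f)
  (at level 3, k at level 2, left associativity).

Definition skew_one : skew_alg := skew_term 1 1%g.

Lemma skew_term_def c k : skew_term c k = monalg.mkmalgU k c.
Proof. by rewrite skew_term.unlock. Qed.

Lemma skew_term0 k : skew_term 0 k = 0.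
Proof. by rewrite skew_term.unlock; apply: monalg.monalgU0. Qed.

Lemma skew_termD k c d : skew_term (c + d) k = skew_term c k + skew_term d k.
Proof. by rewrite skew_term.unlock; apply: monalg.monalgUD. Qed.

Lemma skew_termE f : f = \sum_(k <- msupp f) skew_term (f@_k) k.
Proof. by rewrite skew_term.unlock; apply: monalg.monalgE. Qed.

Lemma skew_ind (P : skew_alg -> Prop) :
  P 0 -> (forall f g, P f -> P g -> P (f + g)) ->
  (forall c k, P (skew_term c k)) -> forall f, P f.
Proof.
move=> P0 PD Pt f; rewrite [f]skew_termE.
by elim/big_ind: _ => // k _; apply: Pt.
Qed.

Lemma skew_mulw (d1 d2 : {fset M}) f g :
  (msupp f `<=` d1)%fset -> (msupp g `<=` d2)%fset ->
  skew_mul f g = \sum_(k <- d1) \sum_(l <- d2)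
    skew_term (f@_k * act k (g@_l)) (k * l)%g.
Proof.
move=> le_d1 le_d2; rewrite skew_mul.unlock (big_fset_incl _ le_d1) /=.
  apply/eq_bigr=> k1 _; apply/big_fset_incl => // k _ /monalg.mcoeff_outdom ->.
  by rewrite rmorph0 mulr0 skew_term0.
move=> k _ /monalg.mcoeff_outdom fk.
by rewrite big1 => // l _; rewrite fk mul0r skew_term0.
Qed.

Fact skew_mulDl : left_distributive skew_mul +%R.
Proof.
move=> f g h.
rewrite (skew_mulw (monalg.msuppD_le f g) (fsubset_refl _)).
rewrite (skew_mulw (fsubsetUl _ (msupp g)) (fsubset_refl _)).
rewrite (skew_mulw (fsubsetUr (msupp f) _) (fsubset_refl _)).
rewrite -big_split /=; apply/eq_bigr=> k _.
rewrite -big_split /=; apply/eq_bigr=> l _.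
by rewrite monalg.mcoeffD mulrDl skew_termD.
Qed.

Fact skew_mulDr : right_distributive skew_mul +%R.
Proof.
move=> h f g.
rewrite (skew_mulw (fsubset_refl _) (monalg.msuppD_le f g)).
rewrite (skew_mulw (fsubset_refl _) (fsubsetUl _ (msupp g))).
rewrite (skew_mulw (fsubset_refl _) (fsubsetUr (msupp f) _)).
rewrite -big_split /=; apply/eq_bigr=> k _.
rewrite -big_split /=; apply/eq_bigr=> l _.
by rewrite monalg.mcoeffD rmorphD mulrDr skew_termD.
Qed.

Fact skew_mul0l : left_zero 0 skew_mul.
Proof.
by move=> f; apply: (addIr (skew_mul 0 f)); rewrite -skew_mulDl !add0r.
Qed.

Fact skew_mul0r : right_zero 0 skew_mul.
Proof.
by move=> f; apply: (addIr (skew_mul f 0)); rewrite -skew_mulDr !add0r.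
Qed.

Lemma skew_mul_term c d k l :
  skew_mul (skew_term c k) (skew_term d l) = skew_term (c * act k d) (k * l)%g.
Proof.
rewrite [X in skew_mul X _]skew_term_def [X in skew_mul _ X]skew_term_def.
rewrite (skew_mulw monalg.msuppU_le monalg.msuppU_le) !big_seq_fset1.
by rewrite !monalg.mcoeffUU.
Qed.

Fact skew_mulA : associative skew_mul.
Proof.
elim/skew_ind=> [g h|f1 f2 IH1 IH2 g h|c k].
- by rewrite !skew_mul0l.
- by rewrite !skew_mulDl IH1 IH2.
elim/skew_ind=> [h|f1 f2 IH1 IH2 h|d l].
- by rewrite !(skew_mul0l, skew_mul0r).
- by rewrite !(skew_mulDl, skew_mulDr) IH1 IH2.
elim/skew_ind=> [|f1 f2 IH1 IH2|e m].
- by rewrite !skew_mul0r.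
- by rewrite !skew_mulDr IH1 IH2.
by rewrite !skew_mul_term rmorphM alg_actM !mulrA mulgA.
Qed.

Fact skew_mul1l : left_id skew_one skew_mul.
Proof.
elim/skew_ind=> [|f g IHf IHg|c k]; first by rewrite skew_mul0r.
  by rewrite skew_mulDr IHf IHg.
by rewrite skew_mul_term mul1r alg_act1 mul1g.
Qed.

Fact skew_mul1r : right_id skew_one skew_mul.
Proof.
elim/skew_ind=> [|f g IHf IHg|c k]; first by rewrite skew_mul0l.
  by rewrite skew_mulDl IHf IHg.
by rewrite skew_mul_term rmorph1 mulr1 mulg1.
Qed.

HB.instance Definition _ := GRing.Zmodule_isPzRing.Build skew_alg
  skew_mulA skew_mul1l skew_mul1r skew_mulDl skew_mulDr.

Definition skew_coef c : skew_alg := skew_term c 1%g.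
Definition skew_elt k : skew_alg := skew_term 1 k.

Lemma skew_termM c d k l :
  skew_term c k * skew_term d l = skew_term (c * act k d) (k * l)%g.
Proof. exact: skew_mul_term. Qed.

Lemma skew_termZ c k : skew_term c k = skew_coef c * skew_elt k.
Proof. by rewrite skew_termM rmorph1 mulr1 mul1g. Qed.

Lemma skew_commute c k :
  skew_elt k * skew_coef c = skew_coef (act k c) * skew_elt k.
Proof. by rewrite !skew_termM mul1r rmorph1 mulr1 mul1g mulg1. Qed.

Fact skew_coef_is_nmod_morphism : nmod_morphism skew_coef.
Proof. by split=> [|c d]; [apply: skew_term0 | apply: skew_termD]. Qed.
Fact skew_coef_is_monoid_morphism : monoid_morphism skew_coef.
Proof. by split=> // c d; rewrite skew_termM alg_act1 mulg1. Qed.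

HB.instance Definition _ :=
  GRing.isNmodMorphism.Build A skew_alg skew_coef skew_coef_is_nmod_morphism.
HB.instance Definition _ := GRing.isMonoidMorphism.Build A skew_alg skew_coef
  skew_coef_is_monoid_morphism.

Fact skew_scalar_central (r : R) f :
  (skew_coef \o rscalar : {rmorphism R -> skew_alg}) r * f =
  f * (skew_coef \o rscalar : {rmorphism R -> skew_alg}) r.
Proof.
rewrite /=; elim/skew_ind: f => [|f g IHf IHg|c k].
  by rewrite mulr0 mul0r.
  by rewrite mulrDr mulrDl IHf IHg.
by rewrite !skew_termM alg_act1 alg_act_scalar mul1g mulg1 rscalar_central.
Qed.

HB.instance Definition _ := hasScalars.Build R skew_alg skew_scalar_central.

End SkewMonoidAlgebra.

Arguments skew_coef {M R A} act c.
Arguments skew_elt {M R A} act k.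

Section MonoidAlgebra.
Variables (R : comPzRingType) (M : monoidType).

Program Definition trivial_action : alg_action M R^o :=
  @AlgAction M R R^o (fun _ => (idfun : {rmorphism R^o -> R^o})) _ _ _.

Definition monoid_alg : Type := skew_alg trivial_action.
HB.instance Definition _ := PzAlgebra.on monoid_alg.

Definition monoid_gen (m : M) : monoid_alg := skew_elt trivial_action m.

Lemma monoid_algC : commutative (@mul M) ->
  @commutative monoid_alg monoid_alg *%R.
Proof.
move=> mulC; elim/skew_ind=> [g|f1 f2 IH1 IH2 g|c k].
- by rewrite mulr0 mul0r.
- by rewrite mulrDr mulrDl IH1 IH2.
elim/skew_ind=> [|f1 f2 IH1 IH2|d l].
- by rewrite mulr0 mul0r.
- by rewrite mulrDr mulrDl IH1 IH2.
by rewrite !skew_termM /= mulrC mulC.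
Qed.

End MonoidAlgebra.

Record monoid_action (W M : monoidType) := MonoidAction {
  monoid_act :> W -> M -> M;
  monoid_act1 : forall x, monoid_act 1%g x = x;
  monoid_actM :
    forall v w x, monoid_act (v * w)%g x = monoid_act v (monoid_act w x);
  monoid_act_one : forall w, monoid_act w 1%g = 1%g;
  monoid_act_mul : forall w x y,
    monoid_act w (x * y)%g = (monoid_act w x * monoid_act w y)%g
}.

Section LinearExtension.
Variables (R : comPzRingType) (W M : monoidType) (rho : monoid_action W M).
Local Notation RM := (monoid_alg R M).
Local Notation term c k := (skew_term (trivial_action R M) c k).

Definition lin_ext (w : W) (f : RM) : RM :=
  \sum_(k <- monalg.msupp f) term (monalg.mcoeff k f) (rho w k).

Lemma lin_extw w (d : {fset M}) (f : RM) : (monalg.msupp f `<=` d)%fset ->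
  lin_ext w f = \sum_(k <- d) term (monalg.mcoeff k f) (rho w k).
Proof.
move=> le_d; rewrite /lin_ext (big_fset_incl _ le_d) //= => k _.
by move=> /monalg.mcoeff_outdom ->; rewrite skew_term0.
Qed.

Lemma lin_ext_term w c k : lin_ext w (term c k) = term c (rho w k).
Proof.
rewrite [X in lin_ext w X]skew_term_def.
by rewrite (lin_extw _ monalg.msuppU_le) big_seq_fset1 monalg.mcoeffUU.
Qed.

Fact lin_ext_is_nmod_morphism w : nmod_morphism (lin_ext w).
Proof.
split=> [|f g]; first by rewrite /lin_ext monalg.msupp0 big_seq_fset0.
rewrite (lin_extw _ (monalg.msuppD_le f g)).
rewrite (lin_extw _ (fsubsetUl _ (monalg.msupp g))).
rewrite (lin_extw _ (fsubsetUr (monalg.msupp f) _)).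
rewrite -big_split /=; apply/eq_bigr=> k _.
by rewrite monalg.mcoeffD skew_termD.
Qed.

HB.instance Definition _ w :=
  GRing.isNmodMorphism.Build RM RM (lin_ext w) (lin_ext_is_nmod_morphism w).

Fact lin_ext_is_monoid_morphism w : monoid_morphism (lin_ext w).
Proof.
split; first by rewrite [LHS]lin_ext_term monoid_act_one.
elim/skew_ind=> [g|f1 f2 IH1 IH2 g|c k].
- by rewrite mul0r raddf0 mul0r.
- by rewrite mulrDl !raddfD /= mulrDl IH1 IH2.
elim/skew_ind=> [|f1 f2 IH1 IH2|d l].
- by rewrite mulr0 raddf0 mulr0.
- by rewrite mulrDr !raddfD /= mulrDr IH1 IH2.
by rewrite skew_termM !lin_ext_term skew_termM monoid_act_mul.
Qed.

HB.instance Definition _ w := GRing.isMonoidMorphism.Build RM RM (lin_ext w)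
  (lin_ext_is_monoid_morphism w).

Fact lin_ext1 f : lin_ext 1%g f = f.
Proof.
elim/skew_ind: f => [|f g IHf IHg|c k]; first exact: raddf0.
  by rewrite raddfD /= IHf IHg.
by rewrite lin_ext_term monoid_act1.
Qed.

Fact lin_extM v w f : lin_ext (v * w)%g f = lin_ext v (lin_ext w f).
Proof.
elim/skew_ind: f => [|f g IHf IHg|c k]; first by rewrite !raddf0.
  by rewrite !raddfD /= IHf IHg.
by rewrite !lin_ext_term monoid_actM.
Qed.

Fact lin_ext_scalar w r : lin_ext w (rscalar r) = rscalar r.
Proof. by rewrite [LHS]lin_ext_term monoid_act_one. Qed.

Definition linear_action : alg_action W RM :=
  @AlgAction W R RM (fun w => (lin_ext w : {rmorphism RM -> RM}))
    lin_ext1 lin_extM lin_ext_scalar.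

End LinearExtension.

Definition free_monoid (X : choiceType) : Type := seq X.
HB.instance Definition _ (X : choiceType) := Choice.on (free_monoid X).
HB.instance Definition _ (X : choiceType) :=
  isMonoid.Build (free_monoid X) (@catA X) (@cat0s X) (@cats0 X).

Definition free_alg (R : comPzRingType) (X : choiceType) : Type :=
  monoid_alg R (free_monoid X).
HB.instance Definition _ (R : comPzRingType) (X : choiceType) :=
  PzAlgebra.on (free_alg R X).

Definition free_gen (R : comPzRingType) (X : choiceType) (x : X) :
  free_alg R X := monoid_gen R ([:: x] : free_monoid X).

Definition idist (m : nat) (i j : 'I_m) : nat := `|i%:Z - j%:Z|%N.

(* Generators are indexed from 0: i : 'I_n.-1 stands for index i + 1. *)
Section BraidsAndTies.
Variables (n : nat) (R : comPzRingType) (u : R).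

Local Notation F := (free_alg R ('I_n.-1 + 'I_n.-1)%type).
Local Notation g i := (free_gen R (inl i : 'I_n.-1 + 'I_n.-1)%type).
Local Notation e i := (free_gen R (inr i : 'I_n.-1 + 'I_n.-1)%type).

Inductive bt_relator : set F :=
| bt_gg_far i j : (1 < idist i j)%N -> bt_relator (g i * g j - g j * g i)
| bt_ggg i j : idist i j = 1%N ->
    bt_relator (g i * g j * g i - g j * g i * g j)
| bt_quadratic i :
    bt_relator (g i ^+ 2 - (1 + rscalar (u - 1) * e i * (1 - g i)))
| bt_ge i j : idist i j != 1%N -> bt_relator (g i * e j - e j * g i)
| bt_gge i j : idist i j = 1%N ->
    bt_relator (g j * g i * e j - e i * g j * g i)
| bt_ee i j : bt_relator (e i * e j - e j * e i)
| bt_idem i : bt_relator (e i ^+ 2 - e i)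
| bt_eeg i j : idist i j = 1%N ->
    bt_relator (e i * e j * g j - e i * g j * e i)
| bt_ege i j : idist i j = 1%N ->
    bt_relator (e i * g j * e i - g j * e i * e j).

Definition bt_algebra : Type := quot_alg bt_relator.
HB.instance Definition _ := PzAlgebra.on bt_algebra.

Definition bt_g (i : 'I_n.-1) : bt_algebra := to_quot bt_relator (g i).
Definition bt_e (i : 'I_n.-1) : bt_algebra := to_quot bt_relator (e i).

End BraidsAndTies.

(* The Coxeter system of type A_(n-1): W = 'S_n and S the set of adjacent
   transpositions. *)
Section AdjacentTranspositions.
Variable n : nat.

Fact adj_hi_subproof (i : 'I_n.-1) : (i.+1 < n)%N.
Proof. by rewrite -ltn_predRL. Qed.

Definition adj_lo (i : 'I_n.-1) : 'I_n := widen_ord (leq_pred n) i.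
Definition adj_hi (i : 'I_n.-1) : 'I_n := Ordinal (adj_hi_subproof i).
Definition adj_tperm (i : 'I_n.-1) : 'S_n := tperm (adj_lo i) (adj_hi i).

Lemma adj_lo_hi i : adj_lo i != adj_hi i.
Proof. by rewrite -val_eqE /= neq_ltn ltnSn. Qed.

End AdjacentTranspositions.

Section BraidGroup.
Variable n : nat.

(* (i, true) is the generator g_i and (i, false) its inverse *)
Definition braid_word : Type := seq ('I_n.-1 * bool).
HB.instance Definition _ := Choice.on braid_word.

Inductive braid_eq : braid_word -> braid_word -> Prop :=
| braid_eq_refl w : braid_eq w w
| braid_eq_sym v w : braid_eq v w -> braid_eq w v
| braid_eq_trans v w x : braid_eq v w -> braid_eq w x -> braid_eq v x
| braid_eq_cat v v' w w' :
    braid_eq v v' -> braid_eq w w' -> braid_eq (v ++ w) (v' ++ w')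
| braid_eq_cancel i b : braid_eq [:: (i, b); (i, ~~ b)] [::]
| braid_eq_far (i j : 'I_n.-1) : (1 < idist i j)%N ->
    braid_eq [:: (i, true); (j, true)] [:: (j, true); (i, true)]
| braid_eq_near (i j : 'I_n.-1) : idist i j = 1%N ->
    braid_eq [:: (i, true); (j, true); (i, true)]
             [:: (j, true); (i, true); (j, true)].

Definition braid_eqb : rel braid_word := fun v w => `[< braid_eq v w >].

Fact braid_eqb_equiv : equiv_class_of braid_eqb.
Proof.
split=> [w|v w|w v x].
- exact/asboolP/braid_eq_refl.
- by apply/asboolP/asboolP; apply: braid_eq_sym.
- by move=> /asboolP vw /asboolP wx; apply/asboolP/(braid_eq_trans vw wx).
Qed.

Canonical braid_eqb_equivRel := EquivRelPack braid_eqb_equiv.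

Definition braid_group : Type := {eq_quot braid_eqb}.
HB.instance Definition _ := Choice.on braid_group.
HB.instance Definition _ := EqQuotient.on braid_group.

Definition braid_of (w : braid_word) : braid_group := \pi_braid_group w.

Lemma braid_ofP v w : braid_of v = braid_of w <-> braid_eq v w.
Proof. by split=> [/eqmodP/asboolP //|vw]; apply/eqmodP/asboolP. Qed.

Lemma braid_ofK b : braid_of (repr b) = b.
Proof. exact: reprK. Qed.

Lemma repr_braid_of w : braid_eq (repr (braid_of w)) w.
Proof. by apply/braid_ofP; rewrite braid_ofK. Qed.

Lemma braid_ind (P : braid_group -> Prop) :
  (forall w, P (braid_of w)) -> forall b, P b.
Proof. by move=> Pw b; rewrite -[b]braid_ofK. Qed.

Definition word_inv (w : braid_word) : braid_word :=
  rev [seq (x.1, ~~ x.2) | x <- w].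

Definition braid_mul (a b : braid_group) : braid_group :=
  braid_of (repr a ++ repr b).
Definition braid_inv (a : braid_group) : braid_group :=
  braid_of (word_inv (repr a)).

Lemma braid_mulE v w : braid_mul (braid_of v) (braid_of w) = braid_of (v ++ w).
Proof. by apply/braid_ofP; apply: braid_eq_cat; apply: repr_braid_of. Qed.

Lemma word_mulVK w : braid_eq (w ++ word_inv w) [::].
Proof.
elim: w => [|[i b] w IHw]; first exact: braid_eq_refl.
have -> : ((i, b) :: w) ++ word_inv ((i, b) :: w) =
    [:: (i, b)] ++ (w ++ word_inv w) ++ [:: (i, ~~ b)].
  by rewrite /word_inv map_cons rev_cons -cats1 /= !catA.
apply: braid_eq_trans (braid_eq_cancel i b).
rewrite -[X in braid_eq _ X]/([:: (i, b)] ++ [::] ++ [:: (i, ~~ b)]).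
apply: braid_eq_cat; first exact: braid_eq_refl.
by apply: braid_eq_cat => //; apply: braid_eq_refl.
Qed.

Lemma word_invK : involutive word_inv.
Proof.
move=> w; rewrite /word_inv map_rev revK -map_comp map_id_in //= => -[i b] _.
by rewrite /= negbK.
Qed.

Fact braid_mulA : associative braid_mul.
Proof.
by elim/braid_ind=> v; elim/braid_ind=> w; elim/braid_ind=> x;
   rewrite !braid_mulE catA.
Qed.
Fact braid_mul1g : left_id (braid_of [::]) braid_mul.
Proof. by elim/braid_ind=> w; rewrite braid_mulE. Qed.
Fact braid_mulg1 : right_id (braid_of [::]) braid_mul.
Proof. by elim/braid_ind=> w; rewrite braid_mulE cats0. Qed.
Fact braid_mulgV : right_inverse (braid_of [::]) braid_inv braid_mul.
Proof.
move=> b; rewrite -[b in braid_mul b _]braid_ofK braid_mulE.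
exact/braid_ofP/word_mulVK.
Qed.
Fact braid_mulVg : left_inverse (braid_of [::]) braid_inv braid_mul.
Proof.
move=> b; rewrite -[b in braid_mul _ b]braid_ofK braid_mulE.
by apply/braid_ofP; rewrite -[X in _ ++ X]word_invK; apply: word_mulVK.
Qed.

HB.instance Definition _ := isGroup.Build braid_group
  braid_mulA braid_mul1g braid_mulg1 braid_mulVg braid_mulgV.

Definition braid_gen (i : 'I_n.-1) : braid_group := braid_of [:: (i, true)].

Definition word_perm (w : braid_word) : 'S_n :=
  (\prod_(x <- w) if x.2 then adj_tperm x.1 else (adj_tperm x.1)^-1)%g.

Lemma word_perm_cat v w : word_perm (v ++ w) = (word_perm v * word_perm w)%g.
Proof. exact: big_cat. Qed.

Definition braid_perm (b : braid_group) : 'S_n := word_perm (repr b).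

End BraidGroup.
Section BraidProjection.
Variable n : nat.
Implicit Types i j : 'I_n.-1.

Lemma adj_tpermK i : (adj_tperm i * adj_tperm i = 1)%g.
Proof. exact: tperm2. Qed.

Lemma adj_tperm_far i j : (1 < idist i j)%N ->
  (adj_tperm i * adj_tperm j = adj_tperm j * adj_tperm i)%g.
Proof.
move=> far_ij; apply/commgP/conjg_fixP; rewrite tpermJ.
by rewrite !tpermD // -val_eqE /=; move: far_ij; rewrite /idist; lia.
Qed.

Lemma adj_tperm_near i j : idist i j = 1%N ->
  (adj_tperm i * adj_tperm j * adj_tperm i =
   adj_tperm j * adj_tperm i * adj_tperm j)%g.
Proof.
move=> near_ij.
suff: (adj_tperm j ^ adj_tperm i = adj_tperm i ^ adj_tperm j)%g.
  by rewrite !conjgE !tpermV !mulgA.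
rewrite !tpermJ.
have [ji|ij] : j.+1 = i :> nat \/ i.+1 = j :> nat.
  by move: near_ij; rewrite /idist; lia.
- have hj : adj_hi j = adj_lo i by apply: val_inj.
  have -> : adj_tperm i (adj_lo j) = adj_lo j.
    by apply: tpermD; rewrite -val_eqE /=; lia.
  have -> : adj_tperm j (adj_hi i) = adj_hi i.
    by apply: tpermD; rewrite -val_eqE /=; lia.
  by rewrite /adj_tperm hj tpermL tpermR.
- have hi : adj_lo j = adj_hi i by apply: val_inj.
  have -> : adj_tperm i (adj_hi j) = adj_hi j.
    by apply: tpermD; rewrite -val_eqE /=; lia.
  have -> : adj_tperm j (adj_lo i) = adj_lo i.
    by apply: tpermD; rewrite -val_eqE /=; lia.
  by rewrite /adj_tperm hi tpermL tpermR.
Qed.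

Lemma word_perm_eq (v w : braid_word n) :
  braid_eq v w -> word_perm v = word_perm w.
Proof.
elim=> {v w} //.
- by move=> v w x _ -> _ ->.
- by move=> v v' w w' _ IHv _ IHw; rewrite !word_perm_cat IHv IHw.
- move=> i b; rewrite /word_perm !big_cons !big_nil mulg1 tpermV.
  by case: b; rewrite /= adj_tpermK.
- move=> i j far_ij; rewrite /word_perm !big_cons !big_nil /= !mulg1.
  exact: adj_tperm_far.
- move=> i j near_ij; rewrite /word_perm !big_cons !big_nil /= !mulg1 !mulgA.
  exact: adj_tperm_near.
Qed.

Lemma braid_permE (w : braid_word n) : braid_perm (braid_of w) = word_perm w.
Proof. exact/word_perm_eq/repr_braid_of. Qed.

Lemma braid_perm_gen i : braid_perm (braid_gen i) = adj_tperm i.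
Proof. by rewrite braid_permE /word_perm big_seq1. Qed.

Lemma braid_perm1 : braid_perm (1%g : braid_group n) = 1%g.
Proof. by rewrite braid_permE /word_perm big_nil. Qed.

Lemma braid_permM (a b : braid_group n) :
  braid_perm (a * b)%g = (braid_perm a * braid_perm b)%g.
Proof.
elim/braid_ind: a => v; elim/braid_ind: b => w.
by rewrite [(_ * _)%g]braid_mulE !braid_permE word_perm_cat.
Qed.

End BraidProjection.

(* The ring E^{(W,S)}(A, rho, a) for (W, S) of type A_(n-1); skew_alg
   braid_action is the skew group ring of B_W over A. *)
Section MarinRing.
Variables (n : nat) (R : comPzRingType) (A : comPzAlgebraType R).
Variable rho : alg_action 'S_n A.

Definition braid_action : alg_action (braid_group n) A.
Proof.
refine (@AlgAction (braid_group n) R A (fun b => rho (braid_perm b)) _ _ _).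
- by move=> x; rewrite braid_perm1 alg_act1.
- by move=> a b x; rewrite braid_permM alg_actM.
- by move=> b r; apply: alg_act_scalar.
Defined.

Record marin_param := MarinParam {
  marin_fun :> 'I_n.-1 -> A;
  marin_unit : forall i, exists v, v * marin_fun i = 1;
  marin_equivariant : forall (w : 'S_n) (i j : 'I_n.-1),
    (w * adj_tperm i * w^-1 = adj_tperm j)%g ->
    rho w (marin_fun i) = marin_fun j
}.

Variable a : marin_param.

Local Notation AB := (skew_alg braid_action).
Local Notation g i := (skew_elt braid_action (braid_gen i)).
Local Notation c x := (skew_coef braid_action x).

Definition marin_relator : set AB :=
  [set x | exists i, x = g i ^+ 2 - c (a i) - (1 - c (a i)) * g i]%classic.

Definition marin_ring : Type := quot_alg marin_relator.
HB.instance Definition _ := PzAlgebra.on marin_ring.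

Definition marin_g (i : 'I_n.-1) : marin_ring := to_quot marin_relator (g i).
Definition marin_coef (x : A) : marin_ring := to_quot marin_relator (c x).

End MarinRing.

(* Phi_W is realized as the vectors epsv i - epsv j, i != j, in Q^n. *)
Section RootSystem.
Variable n : nat.
Local Notation V := 'rV[rat]_n.
Local Open Scope classical_set_scope.

Definition dotv (v w : V) : rat := \sum_(k < n) v 0 k * w 0 k.

Definition reflection (a v : V) : V := v - (2 * dotv v a / dotv a a) *: a.

Definition epsv (i : 'I_n) : V := delta_mx 0 i.

Definition roots : set V :=
  [set a | exists i j : 'I_n, i != j /\ a = epsv i - epsv j].

Definition simple_root (i : 'I_n.-1) : V := epsv (adj_lo i) - epsv (adj_hi i).

(* In 'S_n, (s * t) x = t (s x), so permuting the coordinates by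
   (w v)_k = v_(w k) is a left action; w sends epsv i to epsv (w^-1 i). *)
Definition perm_vec (w : 'S_n) (v : V) : V := col_perm w v.

Lemma perm_vec1 v : perm_vec 1%g v = v.
Proof. exact: col_perm1. Qed.

Lemma perm_vecM w x v : perm_vec (w * x)%g v = perm_vec w (perm_vec x v).
Proof. by apply/rowP=> k; rewrite !mxE permM. Qed.

Lemma perm_vec_eps w i : perm_vec w (epsv i) = epsv (w^-1%g i).
Proof.
apply/rowP=> k; rewrite !mxE !eqxx /=.
by rewrite (can2_eq (permK w) (permKV w)).
Qed.

Lemma perm_vecB w u v : perm_vec w (u - v) = perm_vec w u - perm_vec w v.
Proof. by apply/rowP=> k; rewrite !mxE. Qed.

Lemma dotv_perm w u v : dotv (perm_vec w u) (perm_vec w v) = dotv u v.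
Proof.
rewrite /dotv [RHS](reindex_inj (@perm_inj _ w)) /=.
by apply: eq_bigr => k _; rewrite !mxE.
Qed.

Lemma perm_vec_reflection w a v :
  perm_vec w (reflection a v) = reflection (perm_vec w a) (perm_vec w v).
Proof. by rewrite /reflection !dotv_perm; apply/rowP=> k; rewrite !mxE. Qed.

Lemma reflectionN a v : reflection (- a) v = reflection a v.
Proof.
have dotN w : dotv w (- a) = - dotv w a.
  by rewrite /dotv -sumrN; apply: eq_bigr => k _; rewrite mxE mulrN.
have dotNN : dotv (- a) (- a) = dotv a a.
  by apply: eq_bigr => k _; rewrite !mxE mulrNN.
by rewrite /reflection dotN dotNN mulrN mulNr scaleNr scalerN opprK.
Qed.

Lemma dotv_eps v i j : dotv v (epsv i - epsv j) = v 0 i - v 0 j.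
Proof.
rewrite /dotv.
under eq_bigr => k _ do rewrite !mxE eqxx /= mulrBr !mulr_natr !mulrb.
by rewrite sumrB -!big_mkcond /= !big_pred1_eq.
Qed.

Lemma reflection_root i j v : i != j ->
  reflection (epsv i - epsv j) v = perm_vec (tperm i j) v.
Proof.
move=> ij; have ji : j != i by rewrite eq_sym.
rewrite /reflection !dotv_eps !mxE !eqxx (negPf ij) (negPf ji) /=.
apply/rowP=> k; rewrite !mxE !eqxx /=; case: tpermP => [->|->|/eqP ki /eqP kj].
- by rewrite eqxx (negPf ij) /=; field.
- by rewrite eqxx (negPf ji) /=; field.
- by rewrite (negPf ki) (negPf kj) /=; field.
Qed.

Lemma simple_reflection i v :
  reflection (simple_root i) v = perm_vec (adj_tperm i) v.
Proof. exact/reflection_root/adj_lo_hi. Qed.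

Lemma perm_vec_roots w a : roots a -> roots (perm_vec w a).
Proof.
move=> [i [j [ij ->]]]; exists (w^-1%g i), (w^-1%g j).
by rewrite (inj_eq perm_inj) perm_vecB !perm_vec_eps.
Qed.

Lemma opp_root a : roots a -> roots (- a).
Proof. by move=> [i [j [ij ->]]]; exists j, i; rewrite eq_sym opprB. Qed.

Lemma simple_root_roots i : roots (simple_root i).
Proof. by exists (adj_lo i), (adj_hi i); rewrite adj_lo_hi. Qed.

Definition is_root_subsystem (Psi : set V) : Prop :=
  Psi `<=` roots /\ forall a b, Psi a -> Psi b -> Psi (reflection a b).

Definition root_subsystem_pred : pred (set V) :=
  fun Psi => `[< is_root_subsystem Psi >].

Record root_subsystem : Type := RootSubsystem {
  subsystem_set :> set V;
  subsystem_set_pred : root_subsystem_pred subsystem_set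
}.
HB.instance Definition _ := [isSub for subsystem_set].
HB.instance Definition _ := [Choice of root_subsystem by <:].

Implicit Types P Q T U : root_subsystem.

Lemma root_subsystemP P : is_root_subsystem (P).
Proof. exact/asboolP/(subsystem_set_pred P). Qed.

Definition mk_root_subsystem (Psi : set V) (H : is_root_subsystem Psi) :
  root_subsystem := RootSubsystem (introT (asboolP _) H).

Fact roots_subsystem : is_root_subsystem roots.
Proof.
split=> // _ b [i [j [ij ->]]] rb.
by rewrite reflection_root //; apply: perm_vec_roots.
Qed.

Fact set0_subsystem : is_root_subsystem set0.
Proof. by split. Qed.

Fact gen_subsystem (G : set V) : G `<=` roots ->
  is_root_subsystem (smallest is_root_subsystem G).
Proof.
move=> Gr; split.
  exact: (smallest_sub roots_subsystem Gr).
move=> a b Ha Hb M [HM GM].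
by apply: HM.2; [apply: Ha | apply: Hb].
Qed.

Fact union_roots P Q : P `|` Q `<=` roots.
Proof.
by move=> a [/(root_subsystemP P).1|/(root_subsystemP Q).1].
Qed.

Definition subsystem_one : root_subsystem := mk_root_subsystem set0_subsystem.
Definition subsystem_mul P Q : root_subsystem :=
  mk_root_subsystem (gen_subsystem (@union_roots P Q)).

Lemma subsystem_mulP P Q T :
  (subsystem_mul P Q) `<=` T <-> P `<=` T /\ Q `<=` T.
Proof.
have sub : P `|` Q `<=` (subsystem_mul P Q).
  exact: sub_gen_smallest.
split=> [PQT|[PT QT]].
  by split=> a Ha; apply: PQT; apply: sub; [left|right].
apply: (smallest_sub (root_subsystemP T)).
by move=> a [Pa|Qa]; [apply: PT | apply: QT].
Qed.

Lemma subsystem_eqP P Q :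
  (forall T, P `<=` T <-> Q `<=` T) -> P = Q.
Proof.
move=> PQ; apply/val_inj/seteqP.
by split; [apply/(PQ Q) | apply/(PQ P)].
Qed.

Fact subsystem_mulA : associative subsystem_mul.
Proof.
by move=> P Q T; apply: subsystem_eqP => U; rewrite !subsystem_mulP; tauto.
Qed.
Fact subsystem_mulC : commutative subsystem_mul.
Proof.
by move=> P Q; apply: subsystem_eqP => U; rewrite !subsystem_mulP; tauto.
Qed.
Fact subsystem_mul1g : left_id subsystem_one subsystem_mul.
Proof.
move=> P; apply: subsystem_eqP => U; rewrite !subsystem_mulP.
by split=> [[]|] //; split=> // x [].
Qed.
Fact subsystem_mulg1 : right_id subsystem_one subsystem_mul.
Proof. by move=> P; rewrite subsystem_mulC subsystem_mul1g. Qed.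

HB.instance Definition _ := isMonoid.Build root_subsystem
  subsystem_mulA subsystem_mul1g subsystem_mulg1.

Lemma subsystem_mulgg (P : root_subsystem) : (P * P)%g = P.
Proof.
by apply: subsystem_eqP => U; rewrite subsystem_mulP; tauto.
Qed.

Fact perm_subsystem_subproof (w : 'S_n) P :
  is_root_subsystem (perm_vec w @` P).
Proof.
have [Pr PP] := root_subsystemP P; split.
  by move=> _ [a /Pr ra <-]; apply: perm_vec_roots.
move=> _ _ [a Pa <-] [b Pb <-]; exists (reflection a b); first exact: PP.
exact: perm_vec_reflection.
Qed.

Definition perm_subsystem (w : 'S_n) P : root_subsystem :=
  mk_root_subsystem (perm_subsystem_subproof w P).

Fact perm_subsystem1 P : perm_subsystem 1%g P = P.
Proof.
apply/val_inj/seteqP; split=> [_ [a Pa <-]|a Pa]; first by rewrite perm_vec1.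
by exists a => //; rewrite perm_vec1.
Qed.

Fact perm_subsystemM w x P :
  perm_subsystem (w * x)%g P = perm_subsystem w (perm_subsystem x P).
Proof.
apply/val_inj/seteqP; split=> [_ [a Pa <-]|_ [_ [a Pa <-] <-]].
  by rewrite perm_vecM; exists (perm_vec x a) => //; exists a.
by exists a => //; rewrite perm_vecM.
Qed.

Fact perm_subsystem_one w : perm_subsystem w 1%g = 1%g.
Proof. by apply/val_inj/seteqP; split=> [_ [a []]|a []]. Qed.

Lemma perm_subsystem_sub w P Q :
  (perm_subsystem w P) `<=` Q <->
  P `<=` (perm_subsystem w^-1%g Q).
Proof.
split=> [PQ a Pa|PQ _ [a /PQ [b Qb <-] <-]].
  exists (perm_vec w a); first by apply: PQ; exists a.
  by rewrite -perm_vecM mulVg perm_vec1.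
by rewrite -perm_vecM mulgV perm_vec1.
Qed.

Fact perm_subsystem_mul w P Q :
  perm_subsystem w (P * Q)%g = (perm_subsystem w P * perm_subsystem w Q)%g.
Proof.
apply: subsystem_eqP => U.
by rewrite perm_subsystem_sub !subsystem_mulP !perm_subsystem_sub.
Qed.

Definition subsystem_action : monoid_action 'S_n root_subsystem :=
  MonoidAction perm_subsystem1 perm_subsystemM perm_subsystem_one
    perm_subsystem_mul.

Fact simple_subsystem_subproof (i : 'I_n.-1) :
  is_root_subsystem [set a | a = simple_root i \/ a = - simple_root i].
Proof.
have refl a v : a = simple_root i \/ a = - simple_root i ->
    reflection a v = perm_vec (adj_tperm i) v.
  move=> aE; rewrite -simple_reflection.
  by case: aE => ->; rewrite ?reflectionN.
have perm_s : perm_vec (adj_tperm i) (simple_root i) = - simple_root i.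
  by rewrite perm_vecB !perm_vec_eps tpermV tpermL tpermR opprB.
split=> [a [->|->]|a b Ha Hb]; first exact: simple_root_roots.
  exact/opp_root/simple_root_roots.
rewrite refl //; case: Hb => ->; [right|left] => //.
rewrite -[- _]add0r perm_vecB perm_s opprK /perm_vec.
by apply/rowP=> k; rewrite !mxE add0r.
Qed.

(* <s_i> = {+- alpha_i} *)
Definition simple_subsystem (i : 'I_n.-1) : root_subsystem :=
  mk_root_subsystem (simple_subsystem_subproof i).

Lemma perm_simple_subsystem w i j :
  (w * adj_tperm i * w^-1 = adj_tperm j)%g ->
  perm_subsystem w (simple_subsystem i) = simple_subsystem j.
Proof.
move=> wij.
have swap (x y x' y' : 'I_n) : x' != y' -> tperm x y = tperm x' y' ->
    (x = x' /\ y = y') \/ (x = y' /\ y = x').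
  move=> xy' /permP E; move: (E x') (E y'); rewrite !tpermL !tpermR.
  case: tpermP => [-> ->|-> ->|_ _ e]; [by left|by right|].
  by rewrite e eqxx in xy'.
have wE : perm_vec w (simple_root i) = simple_root j \/
          perm_vec w (simple_root i) = - simple_root j.
  rewrite perm_vecB !perm_vec_eps opprB.
  have := wij; rewrite -{1}[w]invgK -mulgA -conjgE tpermJ.
  by case/(swap _ _ _ _ (adj_lo_hi j)) => -[-> ->]; [left|right].
have wN a : perm_vec w (- a) = - perm_vec w a.
  by apply/rowP=> k; rewrite !mxE.
apply/val_inj/seteqP; split=> [_ [a aE <-]|a aE] /=.
  by case: aE => ->; rewrite ?wN; case: wE => ->; rewrite ?opprK;
    [left|right|right|left].
case: wE => wE; case: aE => ->.
- by exists (simple_root i); [left|].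
- by exists (- simple_root i); [right|rewrite wN wE].
- by exists (- simple_root i); [right|rewrite wN wE opprK].
- by exists (simple_root i); [left|].
Qed.

End RootSystem.

Section GeneratedSubsystems.
Variables (n : nat) (e : 'I_n.-1 -> root_subsystem n).

Inductive gen_by_orbits : root_subsystem n -> Prop :=
| gen_by_orbits_one : gen_by_orbits 1%g
| gen_by_orbits_orbit w i : gen_by_orbits (perm_subsystem w (e i))
| gen_by_orbits_mul P Q :
    gen_by_orbits P -> gen_by_orbits Q -> gen_by_orbits (P * Q)%g.

Definition gen_by_orbits_pred : pred (root_subsystem n) :=
  fun P => `[< gen_by_orbits P >].

(* the monoid Sigma(Phi)_[e] *)
Record gen_subsystems : Type := GenSubsystem {
  gen_subsystem_val : root_subsystem n;
  gen_subsystem_pred : gen_by_orbits_pred gen_subsystem_val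
}.
HB.instance Definition _ := [isSub for gen_subsystem_val].
HB.instance Definition _ := [Choice of gen_subsystems by <:].

Fact gen_by_orbits_closed : monoid_closed gen_by_orbits_pred.
Proof.
split; first exact/asboolP/gen_by_orbits_one.
by move=> P Q /asboolP HP /asboolP HQ; apply/asboolP/gen_by_orbits_mul.
Qed.

HB.instance Definition _ := SubChoice_isSubMonoid.Build
  (root_subsystem n) gen_by_orbits_pred gen_subsystems gen_by_orbits_closed.

Definition mk_gen_subsystem P (H : gen_by_orbits P) : gen_subsystems :=
  GenSubsystem (introT (asboolP _) H).

Lemma gen_subsystemP (P : gen_subsystems) : gen_by_orbits (val P).
Proof. exact/asboolP/(valP P). Qed.

Fact perm_gen_subsystem_subproof w (P : gen_subsystems) :
  gen_by_orbits (perm_subsystem w (val P)).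
Proof.
elim: {P}(val P) / (gen_subsystemP P) => [|x i|P Q _ IHP _ IHQ].
- by rewrite perm_subsystem_one; apply: gen_by_orbits_one.
- by rewrite -perm_subsystemM; apply: gen_by_orbits_orbit.
- by rewrite perm_subsystem_mul; apply: gen_by_orbits_mul.
Qed.

Definition perm_gen_subsystem (w : 'S_n) (P : gen_subsystems) :=
  mk_gen_subsystem (perm_gen_subsystem_subproof w P).

Definition gen_subsystem_action : monoid_action 'S_n gen_subsystems.
Proof.
refine (@MonoidAction 'S_n gen_subsystems perm_gen_subsystem _ _ _ _).
- by move=> P; apply: val_inj; apply: perm_subsystem1.
- by move=> v w P; apply: val_inj; apply: perm_subsystemM.
- by move=> w; apply: val_inj; apply: perm_subsystem_one.
- by move=> w P Q; apply: val_inj; apply: perm_subsystem_mul.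
Defined.

Fact gen_subsystem_mem (i : 'I_n.-1) : gen_by_orbits (e i).
Proof. by rewrite -[e i]perm_subsystem1; apply: gen_by_orbits_orbit. Qed.

Definition gen_subsystem_of (i : 'I_n.-1) : gen_subsystems :=
  mk_gen_subsystem (gen_subsystem_mem i).

Lemma gen_subsystem_mulC : commutative (@mul gen_subsystems).
Proof. by move=> P Q; apply: val_inj; apply: subsystem_mulC. Qed.

Variable R : comPzRingType.

Definition sigma_alg : Type := monoid_alg R gen_subsystems.
HB.instance Definition _ := PzAlgebra.on sigma_alg.
HB.instance Definition _ :=
  GRing.PzSemiRing_hasCommutativeMul.Build sigma_alg
    (monoid_algC gen_subsystem_mulC).

(* the action rho_phi, for phi = id *)
Definition sigma_action : alg_action 'S_n sigma_alg :=
  linear_action R gen_subsystem_action.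

Definition sigma_e (i : 'I_n.-1) : sigma_alg :=
  monoid_gen R (gen_subsystem_of i).

End GeneratedSubsystems.

Section HatE.
Variables (n : nat) (R : comPzRingType) (u : R).
Variable u_unit : exists v, v * u = 1.

Local Notation A := (sigma_alg (@simple_subsystem n) R).
Local Notation e i := (sigma_e (@simple_subsystem n) R i).

Lemma sigma_e_idem i : e i * e i = e i.
Proof.
rewrite [LHS]skew_termM rmorph1 mulr1; congr skew_term.
by apply: val_inj; apply: subsystem_mulgg.
Qed.

Definition hat_e_fun (i : 'I_n.-1) : A := 1 + rscalar (u - 1) * e i.

Fact hat_e_unit i : exists v, v * hat_e_fun i = 1.
Proof.
have [v vu] := u_unit; exists (1 + rscalar (v - 1) * e i).
rewrite /hat_e_fun mulrDl mul1r mulrDr mulr1 mulrACA sigma_e_idem -rmorphM.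
rewrite -addrA -!mulrDl -!rmorphD [X in rscalar X](_ : _ = 0); last by ring: vu.
by rewrite rmorph0 mul0r addr0.
Qed.

Fact hat_e_equivariant (w : 'S_n) (i j : 'I_n.-1) :
  (w * adj_tperm i * w^-1 = adj_tperm j)%g ->
  sigma_action (@simple_subsystem n) R w (hat_e_fun i) = hat_e_fun j.
Proof.
move=> wij; rewrite rmorphD rmorph1 rmorphM alg_act_scalar; congr (_ + _ * _).
rewrite [LHS]lin_ext_term; congr skew_term.
by apply: val_inj; apply: perm_simple_subsystem.
Qed.

Definition hat_e : marin_param (sigma_action (@simple_subsystem n) R) :=
  MarinParam hat_e_unit hat_e_equivariant.

End HatE.

(* Main.v *)
Require Import Defs.
From HB Require Import structures.
From mathcomp Require Import all_boot all_order all_algebra all_fingroup.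
From mathcomp Require Import generic_quotient finmap boolp classical_sets.
From mathcomp Require Import zify ring.
From mathcomp.multinomials Require monalg.

Set Implicit Arguments.
Unset Strict Implicit.
Unset Printing Implicit Defensive.

Import GRing.Theory.
Local Open Scope ring_scope.

(* The two rings have the same universal property. That the defining relations
   of E_n hold in the Marin ring is a computation with root subsystems. For the
   converse let g_i, e_i satisfy the relations of E_n; since u is invertible,
   so is g_i. Put E_{a,a+1} = e_a and E_{a,b+1} = g_b E_{a,b} g_b^-1. The
   relations imply that conjugation by g_k^2 fixes these elements and that
   conjugation by g_k maps E_{a,b} to E_{s_k a,s_k b}. Hence every identity
   between the E_{a,b} need only be checked for one representative of each
   orbit of S_n on tuples of points: they are commuting idempotents with
   E_{a,b} E_{b,c} E_{a,c} = E_{a,b} E_{b,c}. For such a family and any x, the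
   roots eps_a - eps_b with x E_{a,b} = x form a root subsystem, so that
   P |-> prod_(eps_a - eps_b in P) E_{a,b} is multiplicative on root
   subsystems. It is also equivariant, and thus extends to the Marin ring. *)

(** * Universal properties *)

Lemma quot_lift (R : comPzRingType) (A B : pzAlgebraType R) (X : set A)
    (f : {rmorphism A -> B}) : (forall x, X x -> f x = 0) ->
  exists F : {rmorphism quot_alg X -> B}, forall x, F (to_quot X x) = f x.
Proof.
move=> fX; have fI x y : gen_ideal X (x - y) -> f x = f y.
  move=> Ixy; apply/eqP; rewrite -subr_eq0 -rmorphB; apply/eqP.
  elim: Ixy => [z /fX // ||z t _ fz _ ft|z t _ ft|z t _ fz].
  - exact: rmorph0.
  - by rewrite rmorphD fz ft addr0.
  - by rewrite rmorphM ft mulr0.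
  - by rewrite rmorphM fz mul0r.
pose F (a : quot_alg X) := f (repr a).
have FE x : F (to_quot X x) = f x by apply/fI/repr_to_quot.
have F_nmod : nmod_morphism F.
  split; first by rewrite -[0]/(to_quot X 0) FE rmorph0.
  by elim/quot_ind => x; elim/quot_ind => y; rewrite -rmorphD !FE rmorphD.
have F_monoid : monoid_morphism F.
  split; first by rewrite -[1]/(to_quot X 1) FE rmorph1.
  by elim/quot_ind => x; elim/quot_ind => y; rewrite -rmorphM !FE rmorphM.
pose F1 := GRing.isNmodMorphism.Build _ _ F F_nmod.
pose F2 := GRing.isMonoidMorphism.Build _ _ F F_monoid.
pose F' : {rmorphism quot_alg X -> B} := HB.pack F F1 F2.
by exists F'.
Qed.

Section QuotientRules.
Variables (R : comPzRingType) (A : pzAlgebraType R) (X : set A).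
Implicit Types x y : A.

Lemma to_quot1 : to_quot X 1 = 1.
Proof. by []. Qed.

Lemma to_quotD x y : to_quot X (x + y) = to_quot X x + to_quot X y.
Proof. exact: rmorphD. Qed.

Lemma to_quotB x y : to_quot X (x - y) = to_quot X x - to_quot X y.
Proof. exact: rmorphB. Qed.

Lemma to_quotM x y : to_quot X (x * y) = to_quot X x * to_quot X y.
Proof. exact: rmorphM. Qed.

Lemma to_quot_relator x y : X (x - y) -> to_quot X x = to_quot X y.
Proof. by move=> Xxy; apply/to_quotP/gen_ideal_in. Qed.

End QuotientRules.

(** The relation [h k * f c = f (act k c) * h k] is exactly what lets c.k |-> f c * h k respect the
    twisted product. It therefore suffices to compare both sides on single terms. *)
Lemma skew_lift (M : monoidType) (R : comPzRingType) (A : pzAlgebraType R)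
    (act : alg_action M A) (B : pzRingType) (f : {rmorphism A -> B})
    (h : M -> B) :
  h 1%g = 1 -> (forall k l, h (k * l)%g = h k * h l) ->
  (forall k c, h k * f c = f (act k c) * h k) ->
  exists F : {rmorphism skew_alg act -> B},
    forall c k, F (skew_term act c k) = f c * h k.
Proof.
move=> h1 hM hf.
pose F (x : skew_alg act) : B :=
  \sum_(k <- monalg.msupp x) f (monalg.mcoeff k x) * h k.
(* Any finite set containing the support may replace it in the sum, so that the sums for x, y and x
   + y can range over a common set. *)
have Fw (x : skew_alg act) (d : {fset M}) : (monalg.msupp x `<=` d)%fset ->
    F x = \sum_(k <- d) f (monalg.mcoeff k x) * h k.
  move=> le_d; rewrite /F (big_fset_incl _ le_d) //= => k _.
  by move=> /monalg.mcoeff_outdom ->; rewrite rmorph0 mul0r.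
have FE c k : F (skew_term act c k) = f c * h k.
  rewrite [X in F X]skew_term_def (Fw _ _ monalg.msuppU_le) big_seq_fset1.
  by rewrite monalg.mcoeffUU.
have F_nmod : nmod_morphism F.
  split=> [|x y]; first by rewrite /F monalg.msupp0 big_seq_fset0.
  rewrite (Fw _ _ (monalg.msuppD_le x y)).
  rewrite (Fw _ _ (fsubsetUl _ (monalg.msupp y))).
  rewrite (Fw _ _ (fsubsetUr (monalg.msupp x) _)).
  rewrite -big_split /=; apply/eq_bigr => k _.
  by rewrite monalg.mcoeffD rmorphD mulrDl.
pose F1 := GRing.isNmodMorphism.Build _ _ F F_nmod.
have [F0 FD] := F_nmod.
have F_monoid : monoid_morphism F.
  split; first by rewrite [LHS]FE rmorph1 h1 mulr1.
  elim/skew_ind=> [y|x y IHx IHy z|c k].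
  - by rewrite mul0r F0 mul0r.
  - by rewrite mulrDl !FD IHx IHy -mulrDl.
  elim/skew_ind=> [|x y IHx IHy|d l].
  - by rewrite mulr0 F0 mulr0.
  - by rewrite mulrDr !FD IHx IHy -mulrDr.
  rewrite skew_termM !FE rmorphM hM -!mulrA; congr (_ * _).
  by rewrite !mulrA hf.
pose F2 := GRing.isMonoidMorphism.Build _ _ F F_monoid.
pose F'' : {rmorphism skew_alg act -> B} := HB.pack F F1 F2.
by exists F''.
Qed.

Lemma monoid_alg_lift (R : comPzRingType) (M : monoidType)
    (B : pzAlgebraType R) (h : M -> B) :
  h 1%g = 1 -> (forall k l, h (k * l)%g = h k * h l) ->
  exists F : {rmorphism monoid_alg R M -> B},
    alg_morphism F /\ forall k, F (monoid_gen R k) = h k.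
Proof.
move=> h1 hM; pose f : {rmorphism R^o -> B} := @rscalar R B.
have [//|//|k c|F FE] :=
  skew_lift (act := trivial_action R M) (f := f) (h := h).
  exact/esym/rscalar_central.
exists F; split=> [r|k]; first by rewrite [LHS]FE h1 mulr1.
by rewrite [LHS]FE rmorph1 mul1r.
Qed.

Lemma free_alg_lift (R : comPzRingType) (X : choiceType)
    (B : pzAlgebraType R) (h : X -> B) :
  exists F : {rmorphism free_alg R X -> B},
    alg_morphism F /\ forall x, F (free_gen R x) = h x.
Proof.
pose H (w : free_monoid X) : B := \prod_(x <- (w : seq X)) h x.
have [||F [FR FE]] := monoid_alg_lift (h := H).
- by rewrite /H big_nil.
- by move=> v w; rewrite /H big_cat.
by exists F; split=> // x; rewrite [LHS]FE /H big_seq1.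
Qed.

Lemma monoid_alg_ind (R : comPzRingType) (M : monoidType)
    (K : monoid_alg R M -> Prop) :
  (forall x y, K x -> K y -> K (x + y)) ->
  (forall x y, K x -> K y -> K (x * y)) ->
  (forall r, K (rscalar r)) -> (forall k, K (monoid_gen R k)) -> forall x, K x.
Proof.
move=> KD KM KR Kg; elim/skew_ind => // [|c k].
  by rewrite -(rmorph0 rscalar).
by rewrite skew_termZ; apply: KM; [exact: KR | exact: Kg].
Qed.

Lemma free_alg_ind (R : comPzRingType) (X : choiceType)
    (K : free_alg R X -> Prop) :
  (forall x y, K x -> K y -> K (x + y)) ->
  (forall x y, K x -> K y -> K (x * y)) ->
  (forall r, K (rscalar r)) -> (forall x, K (free_gen R x)) -> forall x, K x.
Proof.
move=> KD KM KR Kg; apply: monoid_alg_ind => // w.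
elim: w => [|x w IHw]; first by move: (KR 1); rewrite rmorph1.
rewrite (_ : monoid_gen _ _ =
  free_gen R x * monoid_gen R (w : free_monoid X)); first exact: KM.
by rewrite [RHS]skew_termM rmorph1 mulr1.
Qed.

(** * Conjugates of adjacent ties *)

Section TieOrbit.
Variables (X : Type) (m : nat) (c : nat -> X -> X) (e : nat -> X).

(* [tie_from a d] is E_{a,a+d+1}. *)
Fixpoint tie_from (a d : nat) : X :=
  if d is d'.+1 then c (a + d)%N (tie_from a d') else e a.

(** The endpoints are sorted first, which makes the family symmetric. On the diagonal the truncated
    predecessor yields the default value [e a]. *)
Definition tie (a b : nat) : X :=
  if (a < b)%N then tie_from a (b - a).-1 else tie_from b (a - b).-1.

Lemma tieC a b : tie a b = tie b a.
Proof. by rewrite /tie; case: (ltngtP a b) => // ->. Qed.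

Lemma tie_succ a : tie a a.+1 = e a.
Proof. by rewrite /tie ltnSn subSnn. Qed.

Lemma tieS a b : (a < b)%N -> tie a b.+1 = c b (tie a b).
Proof.
move=> ab; rewrite /tie ab ltnS (ltnW ab).
have -> : (b.+1 - a).-1 = (b - a).-1.+1 by lia.
by rewrite /=; congr c; lia.
Qed.

(** These hypotheses record what remains of conjugation by braid generators once the ring is
    forgotten: [c i] stands for conjugation by g_i and [e i] for E_{i,i+1}. Generators have indices
    below [m], points have indices up to [m] inclusive. *)
Hypothesis c_inj : forall i, (i < m)%N -> injective (c i).
Hypothesis c_far : forall i j x, (i.+1 < j)%N -> (j < m)%N ->
  c i (c j x) = c j (c i x).
Hypothesis c_near : forall i x, (i.+1 < m)%N ->
  c i (c i.+1 (c i x)) = c i.+1 (c i (c i.+1 x)).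
Hypothesis c_self : forall i, (i < m)%N -> c i (e i) = e i.
Hypothesis c_e_far : forall i j, (i.+1 < j)%N -> (j < m)%N ->
  c i (e j) = e j /\ c j (e i) = e i.
Hypothesis c_e_near : forall i, (i.+1 < m)%N -> c i (c i.+1 (e i)) = e i.+1.
Hypothesis c_e_sq : forall i, (i.+1 < m)%N ->
  c i (c i (e i.+1)) = e i.+1 /\ c i.+1 (c i.+1 (e i)) = e i.

(** Every conjugation that builds E_{a,b} has index at most b - 1, hence is far from k, and so is
    the initial tie [e a]. *)
Lemma tie_above k a b : (a < b)%N -> (b < k)%N -> (k < m)%N ->
  c k (tie a b) = tie a b.
Proof.
elim: b => // b IHb; rewrite ltnS leq_eqVlt => /predU1P[<-|ab] bk km.
  by rewrite tie_succ (c_e_far _ km).2.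
by rewrite tieS // -c_far // IHb // ltnW.
Qed.

Lemma tie_below k a b : (k.+1 < a)%N -> (a < b)%N -> (b <= m)%N ->
  c k (tie a b) = tie a b.
Proof.
move=> ka; elim: b => // b IHb; rewrite ltnS leq_eqVlt => /predU1P[<-|ab] bm.
  by rewrite tie_succ (c_e_far _ bm).1.
by rewrite tieS // c_far ?IHb //; lia.
Qed.

Lemma tie_sq_above k a : (a < k)%N -> (k < m)%N ->
  c k (c k (tie a k)) = tie a k.
Proof.
elim: k => // k IHk; rewrite ltnS leq_eqVlt => /predU1P[<-|ak] km.
  by rewrite tie_succ (c_e_sq km).2.
have fixE := tie_above ak (ltnSn k) km.
(* Since c_{k+1} fixes E_{a,k}, it may be inserted; two braid moves then turn c_{k+1}^2 c_k c_{k+1}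
   into c_k c_{k+1} c_k^2, and the induction hypothesis removes c_k^2. *)
by rewrite tieS // -[in LHS]fixE -c_near // -c_near // IHk ?fixE // ltnW.
Qed.

Lemma tie_at_low k b : (k.+1 < b)%N -> (b <= m)%N ->
  c k (tie k b) = tie k.+1 b.
Proof.
elim: b => // b IHb; rewrite ltnS leq_eqVlt => /predU1P[<-|kb] bm.
  by rewrite tieS // !tie_succ c_e_near.
by rewrite (tieS kb) (tieS (ltnW kb)) c_far ?IHb // ltnW.
Qed.

Lemma tie_sq_low k b : (k.+1 < b)%N -> (b <= m)%N ->
  c k (c k (tie k b)) = tie k b.
Proof.
elim: b => // b IHb; rewrite ltnS leq_eqVlt => /predU1P[<-|kb] bm.
  (* One more application of [c k] turns the claim on E_{k,k+2} into the same claim on the adjacent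
     tie E_{k+1,k+2}. *)
  apply: (@c_inj k); first exact: ltnW.
  by rewrite tie_at_low // tie_succ (c_e_sq bm).1.
by rewrite (tieS (ltnW kb)) !(c_far _ kb) ?IHb // ltnW.
Qed.

Lemma tie_between k a b : (a < k)%N -> (k.+1 < b)%N -> (b <= m)%N ->
  c k (tie a b) = tie a b.
Proof.
move=> ak; elim: b => // b IHb; rewrite ltnS leq_eqVlt => /predU1P[<-|kb] bm.
  (* Here E_{a,k+2} = c_{k+1} c_k E_{a,k}; the braid relation moves c_{k+1} to the inside, where it
     fixes E_{a,k}. *)
  by rewrite (tieS (leqW ak)) (tieS ak) c_near // tie_above.
by rewrite tieS 1?c_far ?IHb //; lia.
Qed.

(** The proof goes through the positions of a < b relative to k and k+1. When exactly one endpoint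
    is involved and it equals k+1, the tie is itself [c k] of the tie with endpoint k, so the claim
    becomes the triviality of [c k] squared. *)
Lemma tie_adj (k a b : nat) : (k < m)%N -> (a <= m)%N -> (b <= m)%N -> a != b ->
  let s x := if x == k then k.+1 else if x == k.+1 then k else x in
  c k (tie a b) = tie (s a) (s b).
Proof.
move=> km am bm ab s; wlog lt_ab : a b am bm ab / (a < b)%N.
  move=> H; have [lt_ab|lt_ba|eq_ab] := ltngtP a b; first exact: H.
    by rewrite tieC H 1?eq_sym // tieC.
  by rewrite eq_ab eqxx in ab.
rewrite /s; case: (ltngtP a k) => [ak|ka|Ea].
- rewrite (_ : (a == k.+1) = false); last by lia.
  case: (ltngtP b k) => [bk|kb|->].
  + by rewrite (_ : (b == k.+1) = false) ?tie_above //; lia.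
  + case: eqP => [->|/eqP bk1]; first by rewrite tieS // tie_sq_above.
    by apply: tie_between => //; lia.
  + by rewrite tieS.
- rewrite (_ : (b == k) = false); last by lia.
  rewrite (_ : (b == k.+1) = false); last by lia.
  case: eqP => [Ea|/eqP ak1]; last by apply: tie_below => //; lia.
  by rewrite Ea in lt_ab *; rewrite -tie_at_low ?tie_sq_low.
- rewrite Ea in lt_ab *; rewrite (_ : (b == k) = false); last by lia.
  case: eqP => [->|/eqP bk1]; last by apply: tie_at_low; lia.
  by rewrite [RHS]tieC tie_succ c_self.
Qed.

End TieOrbit.

(** * Adjacent transpositions *)

Section AdjacentGeneration.
Variable n : nat.
Implicit Types (i : 'I_n.-1) (a b : 'I_n) (w : 'S_n).

Lemma adj_tperm_val i a : adj_tperm i a =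
  (if a == i :> nat then i.+1 else if a == i.+1 :> nat then i : nat else a)
    :> nat.
Proof.
have lo x : (x == adj_lo i) = (x == i :> nat) by [].
have hi x : (x == adj_hi i) = (x == i.+1 :> nat) by [].
case: tpermP => [->|->|/eqP Na /eqP Nb] /=.
- by rewrite eqxx.
- by rewrite eqxx (gtn_eqF (ltnSn i)).
- by rewrite lo in Na; rewrite hi in Nb; rewrite (negPf Na) (negPf Nb).
Qed.

Lemma word_perm_surj w : exists v : braid_word n, word_perm v = w.
Proof.
pose H w := exists v : braid_word n, word_perm v = w.
have HM v x : H v -> H x -> H (v * x)%g.
  by move=> [v' <-] [x' <-]; exists (v' ++ x'); rewrite word_perm_cat.
have Hadj i : H (adj_tperm i).
  by exists [:: (i, true)]; rewrite /word_perm big_seq1.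
have Ht a d b : (a + d = b)%N -> H (tperm a b).
  elim: d b => [|d IHd] b ab.
    have <- : a = b by apply: val_inj => /=; lia.
    by rewrite tperm1; exists [::]; rewrite /word_perm big_nil.
  have d_lt : (a + d < n.-1)%N by have := ltn_ord b; lia.
  pose i := Ordinal d_lt.
  have hi : adj_hi i = b by apply: val_inj => /=; lia.
  have [d0|d_gt0] := posnP d.
    have -> : a = adj_lo i by apply: val_inj => /=; lia.
    by rewrite -hi; apply: Hadj.
  (* The transposition s_i fixes a and takes [adj_lo i] to b, so (a b) is the conjugate by s_i of
     the shorter transposition of a and [adj_lo i]. *)
  rewrite -hi -[adj_hi i](tpermL (adj_lo i)) -/(adj_tperm i).
  rewrite -[a in tperm a _](_ : adj_tperm i a = a); last first.
    by apply: tpermD; rewrite -val_eqE /=; lia.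
  rewrite -tpermJ conjgE tpermV; apply/HM; first exact: Hadj.
  by apply: HM; [exact: IHd | exact: Hadj].
have {}Ht a b : H (tperm a b).
  have [ab|ba] := leqP a b; first by apply: (Ht _ (b - a)%N); lia.
  by rewrite tpermC; apply: (Ht _ (a - b)%N); lia.
have [ts -> _] := prod_tpermP w.
apply: (big_ind H) => [|v x|p _]; [|exact: HM|exact: Ht].
by exists [::]; rewrite /word_perm big_nil.
Qed.

(** Adjacent transpositions are involutions, so inverse letters of a word need no case of their own.
    The induction extends w on the right because [w * adj_tperm i] applies s_i after w, which on
    ties is one further conjugation by g_i. *)
Lemma adj_tperm_closed (H : 'S_n -> Prop) :
  H 1%g -> (forall w i, H w -> H (w * adj_tperm i)%g) -> forall w, H w.
Proof.
move=> H1 HS w; have [v <-] := word_perm_surj w.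
elim/last_ind: v => [|v [i b] IHv]; first by rewrite /word_perm big_nil.
rewrite -cats1 word_perm_cat /word_perm big_seq1 /= tpermV.
by case: b; apply: HS.
Qed.

End AdjacentGeneration.

(** A permutation that is correct on the tail is corrected at the head by the transposition of [w a]
    and [b], which misses the tail because both tuples are injective. *)
Lemma perm_extend (T : finType) (s t : seq T) :
  uniq s -> uniq t -> size s = size t -> exists w : {perm T}, map w s = t.
Proof.
elim: s t => [|a s IHs] [|b t] //=; first by exists 1%g.
move=> /andP[a_s Us] /andP[b_t Ut] [/(IHs _ Us Ut)[w wst]].
exists (w * tperm (w a) b)%g; rewrite permM tpermL; congr cons.
rewrite -wst; apply/eq_in_map => x xs; rewrite permM tpermD //.
  by rewrite (inj_eq perm_inj); apply: contraNneq a_s => ->.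
by apply: contraNneq b_t => ->; rewrite -wst map_f.
Qed.

(** * Products of ties over root subsystems *)

Section NoncommutativeProducts.
Variables (B : pzRingType) (I : eqType) (P : pred I) (F : I -> B).

Lemma mul_prod_fix x r :
  (forall i, P i -> x * F i = x) -> x * \prod_(i <- r | P i) F i = x.
Proof.
move=> xF; elim/big_ind: _ => [|y z xy xz|]; first by rewrite mulr1.
  by rewrite mulrA xy.
exact: xF.
Qed.

(** The extra factor is commuted back to its own occurrence in the product and absorbed there by
    idempotence. *)
Lemma prod_mul_fix i r :
  (forall j k, P j -> P k -> GRing.comm (F j) (F k)) ->
  (forall j, P j -> F j * F j = F j) -> i \in r -> P i ->
  \prod_(j <- r | P j) F j * F i = \prod_(j <- r | P j) F j.
Proof.
move=> FC FF; elim: r => // j r IHr; rewrite inE big_cons.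
have [<- _ Pi|_ /= /IHr{IHr}IHr Pi] := eqVneq i j.
  rewrite Pi -mulrA -[X in _ * X]commr_prod ?mulrA ?FF // => k Pk.
  exact: FC.
by case: ifP => _; rewrite -?mulrA IHr.
Qed.

End NoncommutativeProducts.

Section TieProduct.
Variables (n : nat) (B : pzRingType) (E : 'I_n -> 'I_n -> B).
Implicit Types (a b c d : 'I_n) (P Q : root_subsystem n) (x : B).

Hypothesis EC : forall a b, E a b = E b a.
Hypothesis E_idem : forall a b, a != b -> E a b * E a b = E a b.
Hypothesis E_comm : forall a b c d, a != b -> c != d ->
  GRing.comm (E a b) (E c d).
Hypothesis E_trans : forall a b c, a != b -> b != c -> a != c ->
  E a b * E b c * E a c = E a b * E b c.

Definition has_root P (p : 'I_n * 'I_n) : bool :=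
  `[< (P : set _) (epsv p.1 - epsv p.2) >].

(** The index set consists of ordered pairs, which keeps the product finite. A root and its negative
    contribute the same tie twice, harmlessly for idempotents; the order of enumeration does not
    matter for commuting ones. *)
Definition tie_prod P : B := \prod_(p | has_root P p) E p.1 p.2.

Lemma root_inj a b c d : a != b -> epsv a - epsv b = epsv c - epsv d ->
  a = c /\ b = d.
Proof.
move=> ab /rowP E1; have ba : b != a by rewrite eq_sym.
have := E1 a; have := E1 b; rewrite !mxE !eqxx (negPf ab) (negPf ba) /=.
by case: (b =P c); case: (b =P d); case: (a =P c); case: (a =P d) => /=.
Qed.

Lemma has_root_neq P p : has_root P p -> p.1 != p.2.
Proof.
move=> /asboolP/(root_subsystemP P).1[a [b [ab]]] /esym Eab.
by have [<- <-] := root_inj ab Eab.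
Qed.

Lemma has_rootP P a b : has_root P (a, b) <-> (P : set _) (epsv a - epsv b).
Proof. by split => /asboolP. Qed.

Lemma tie_prod_fix P p : has_root P p -> tie_prod P * E p.1 p.2 = tie_prod P.
Proof.
move=> Pp; apply: (prod_mul_fix (F := fun p => E p.1 p.2)) => //.
- by move=> q r /has_root_neq Pq /has_root_neq Pr; apply: E_comm.
- by move=> q /has_root_neq; apply: E_idem.
- exact: mem_index_enum.
Qed.

Lemma tie_prod_comm P x :
  (forall a b, a != b -> GRing.comm x (E a b)) -> GRing.comm x (tie_prod P).
Proof. by move=> xE; apply: commr_prod => p /has_root_neq; apply: xE. Qed.

Lemma tie_prodC P Q : GRing.comm (tie_prod P) (tie_prod Q).
Proof.
apply: tie_prod_comm => a b ab; apply/commr_sym/tie_prod_comm => c d.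
exact: E_comm.
Qed.

(** The relation [Y], equality or absorption of the tie by x, is an equivalence on points. If t = (i
    j) comes from an absorbed root, then t c is equivalent to c for all c, so t a ~ a ~ b ~ t b for
    any absorbed root eps_a - eps_b, and its reflection is absorbed too. *)
Lemma fixed_roots_subsystem x : is_root_subsystem
  (fun v => exists a b, [/\ a != b, v = epsv a - epsv b & x * E a b = x]).
Proof.
pose Y a b := a = b \/ x * E a b = x.
have YC a b : Y a b -> Y b a by case=> [->|?]; [left | right; rewrite EC].
have YT (a b c : 'I_n) : Y a b -> Y b c -> Y a c.
  move=> [<- //|Yab] [<-|Ybc]; first by right.
  have [ab|ab] := eqVneq a b; first by right; rewrite ab.
  have [bc|bc] := eqVneq b c; first by right; rewrite -bc.
  have [ac|ac] := eqVneq a c; first by left.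
  (* Write x as x E_{a,b} E_{b,c}, which absorbs E_{a,c} by [E_trans]. *)
  right; rewrite -[x in x * _]Ybc -[x in x * _ * _]Yab -!mulrA [E a b * _]mulrA.
  by rewrite E_trans // mulrA Yab.
split=> [_ [a [b [ab -> _]]]|_ _ [i [j [ij -> Yij]]] [a [b [ab -> Yab]]]].
  by exists a, b.
have Yt c : Y (tperm i j c) c.
  case: tpermP => [->|->|_ _]; [right; rewrite EC // | by right | by left].
exists (tperm i j a), (tperm i j b).
rewrite (inj_eq perm_inj) reflection_root // perm_vecB !perm_vec_eps tpermV.
split=> //; have: Y (tperm i j a) (tperm i j b).
  by apply: (YT _ _ _ (Yt a)); apply: (YT _ b); [right | apply/YC/Yt].
by case=> // /perm_inj Eab; rewrite Eab eqxx in ab.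
Qed.

Lemma mul_tie_prod_fix P x : (forall a b, has_root P (a, b) -> x * E a b = x) ->
  x * tie_prod P = x.
Proof. by move=> xP; apply: mul_prod_fix => -[a b]; apply: xP. Qed.

(** This is antisymmetry of the absorption order. It allows products over different index sets, or
    in different orders, to be compared without matching their factors. *)
Lemma comm_fix_eq x y : GRing.comm x y -> x * y = x -> y * x = y -> x = y.
Proof. by move=> xyC xy yx; rewrite -xy xyC. Qed.

Lemma tie_prod1 : tie_prod 1%g = 1.
Proof. by rewrite /tie_prod big1 // => p /asboolP []. Qed.

Lemma tie_prodM P Q : tie_prod (P * Q)%g = tie_prod P * tie_prod Q.
Proof.
have PQ_sub : (P `<=` (P * Q)%g /\ Q `<=` (P * Q)%g)%classic.
  exact/subsystem_mulP.
apply/esym/comm_fix_eq.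
- by apply/commr_sym/commrM; apply: tie_prodC.
- apply: mul_tie_prod_fix => a b /has_rootP.
  set x := tie_prod P * tie_prod Q.
  (* The roots absorbed by x form a subsystem [T] containing P and Q, hence also the subsystem they
     generate. *)
  pose T := mk_root_subsystem (fixed_roots_subsystem x).
  suff /subsystem_mulP sub : (P `<=` T /\ Q `<=` T)%classic.
    move=> PQab; have [c [d [cd /esym Ecd xcd]]] := sub _ PQab.
    by by have [<- <-] := root_inj cd Ecd.
  split=> v vP.
    have [c [d [cd Ev]]] := (root_subsystemP P).1 v vP; exists c, d; split=> //.
    have Pcd : has_root P (c, d) by apply/has_rootP; rewrite -Ev.
    by rewrite /x tie_prodC -mulrA (tie_prod_fix Pcd).
  have [c [d [cd Ev]]] := (root_subsystemP Q).1 v vP; exists c, d; split=> //.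
  have Qcd : has_root Q (c, d) by apply/has_rootP; rewrite -Ev.
  by rewrite /x -mulrA (tie_prod_fix Qcd).
- have fixU (U : root_subsystem n) : (U `<=` (P * Q)%g)%classic ->
      tie_prod (P * Q)%g * tie_prod U = tie_prod (P * Q)%g.
    move=> sub; apply: mul_tie_prod_fix => a b /has_rootP/sub Hab.
    exact/(tie_prod_fix (p := (a, b)))/has_rootP.
  by rewrite mulrA (fixU P) ?(fixU Q) //; apply PQ_sub.
Qed.

Lemma tie_prod_simple (i : 'I_n.-1) :
  tie_prod (simple_subsystem i) = E (adj_lo i) (adj_hi i).
Proof.
apply: comm_fix_eq.
- apply/commr_sym/tie_prod_comm => a b ab. exact: E_comm (adj_lo_hi i) ab.
- exact/(tie_prod_fix (p := (_, _)))/has_rootP/or_introl.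
- apply: mul_tie_prod_fix => a b Hab; have ab := has_root_neq Hab.
  have [|] := (has_rootP _ _ _).1 Hab; rewrite /simple_root ?opprB.
    by case/root_inj => // -> ->; apply/E_idem/adj_lo_hi.
  case/root_inj => // -> ->; rewrite [E (adj_hi i) _]EC.
  exact/E_idem/adj_lo_hi.
Qed.

(** The permutation w sends eps_i to the vector eps with index w^-1 i, which is why w itself, not
    its inverse, appears on the indices. *)
Lemma has_root_perm w P a b :
  has_root (perm_subsystem w P) (a, b) = has_root P (w a, w b).
Proof.
apply/asboolP/asboolP => /=.
  move=> [v Pv Ev].
  suff -> : epsv (w a) - epsv (w b) = v by [].
  rewrite -[v]perm_vec1 -(mulVg w) perm_vecM Ev perm_vecB.
  by rewrite !perm_vec_eps invgK.
move=> Pab; exists (epsv (w a) - epsv (w b)) => //.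
by rewrite perm_vecB !perm_vec_eps !permK.
Qed.

(** Conjugating factor by factor would give the right factors in another order. Instead the
    conjugate g T g' of T = [tie_prod P] is shown to commute with the target, and each is shown to
    absorb the factors of the other. *)
Lemma tie_prod_perm (w : 'S_n) (g g' : B) P : g' * g = 1 -> g * g' = 1 ->
  (forall a b, a != b -> g * E (w a) (w b) = E a b * g) ->
  g * tie_prod P = tie_prod (perm_subsystem w P) * g.
Proof.
move=> g'g gg' gE; have g'E a b : a != b -> E (w a) (w b) * g' = g' * E a b.
  move=> ab; rewrite -[LHS]mul1r -g'g -mulrA [g * _]mulrA gE //.
  by rewrite -!mulrA gg' mulr1.
suff <- : g * tie_prod P * g' = tie_prod (perm_subsystem w P).
  by rewrite -mulrA g'g mulr1.
apply: comm_fix_eq.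
- apply: tie_prod_comm => a b ab; rewrite /GRing.comm -mulrA -g'E //.
  rewrite mulrA -[g * _ * _]mulrA.
  rewrite -(@tie_prod_comm P (E (w a) (w b))) 1?mulrA ?gE // ?mulrA // => c d.
  by apply: E_comm; rewrite (inj_eq perm_inj).
- apply: mul_tie_prod_fix => a b Pab; have ab := has_root_neq Pab.
  rewrite -mulrA -g'E // mulrA -[g * _ * _]mulrA.
  rewrite (tie_prod_fix (p := (_, _))) //.
  by rewrite -has_root_perm.
- set x := tie_prod (perm_subsystem w P).
  have xg : x * g * tie_prod P = x * g.
    apply: mul_tie_prod_fix => a b; rewrite -[a](permKV w) -[b](permKV w).
    rewrite -has_root_perm => Pab; have ab := has_root_neq Pab.
    by rewrite -mulrA gE // mulrA (tie_prod_fix Pab).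
  by rewrite !mulrA xg -mulrA gg' mulr1.
Qed.

End TieProduct.

(** * Rings satisfying the relations of braids and ties *)

Section TieRelations.
Variables (m : nat) (B : pzRingType).
(** In this form both ['I_n] and ['I_n.-1] are ordinals below a successor, so [inord] translates
    natural numbers into points and into generator indices. *)
Local Notation n := m.+2.
Variables (g g' e : 'I_n.-1 -> B) (r : B).
Implicit Types (i j : 'I_n.-1) (a b c d : 'I_n) (x y : B).

Hypothesis gV : forall i, g i * g' i = 1.
Hypothesis Vg : forall i, g' i * g i = 1.
Hypothesis g_far : forall i j, (1 < idist i j)%N -> g i * g j = g j * g i.
Hypothesis g_near : forall i j, idist i j = 1%N ->
  g i * g j * g i = g j * g i * g j.
Hypothesis r_central : forall x, r * x = x * r.
Hypothesis g_sq : forall i, g i * g i = 1 + r * e i * (1 - g i).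
Hypothesis ge_far : forall i j, idist i j != 1%N -> g i * e j = e j * g i.
Hypothesis gge : forall i j, idist i j = 1%N ->
  g j * g i * e j = e i * g j * g i.
Hypothesis eC : forall i j, e i * e j = e j * e i.
Hypothesis ee : forall i, e i * e i = e i.
Hypothesis eeg : forall i j, idist i j = 1%N ->
  e i * e j * g j = e i * g j * e i.
Hypothesis ege : forall i j, idist i j = 1%N ->
  e i * g j * e i = g j * e i * e j.

Definition conj_gen i x : B := g i * x * g' i.

Lemma conj_genE i x y : g i * x = y * g i -> conj_gen i x = y.
Proof. by rewrite /conj_gen => ->; rewrite -mulrA gV mulr1. Qed.

Lemma conj_genK i x : conj_gen i x * g i = g i * x.
Proof. by rewrite /conj_gen -mulrA Vg mulr1. Qed.

Lemma conj_gen_inj i : injective (conj_gen i).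
Proof.
move=> x y /(congr1 (fun z => g' i * (z * g i))).
by rewrite !conj_genK !mulrA Vg !mul1r.
Qed.

Lemma conj_genM i x y : conj_gen i (x * y) = conj_gen i x * conj_gen i y.
Proof. by rewrite {3}/conj_gen !mulrA conj_genK /conj_gen !mulrA. Qed.

Lemma mulg_inj i : injective (fun x => x * g i).
Proof.
by move=> x y /= /(congr1 (fun z => z * g' i)); rewrite -!mulrA gV !mulr1.
Qed.

Lemma conj_gen2E i j x y : g i * g j * x = y * g i * g j ->
  conj_gen i (conj_gen j x) = y.
Proof.
move=> E; apply/(@mulg_inj i)/(@mulg_inj j).
by rewrite conj_genK -mulrA conj_genK mulrA.
Qed.

Lemma conj_gen_far i j x : (1 < idist i j)%N ->
  conj_gen i (conj_gen j x) = conj_gen j (conj_gen i x).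
Proof.
move=> ij; apply: conj_gen2E; rewrite -[RHS]mulrA (g_far ij) [RHS]mulrA.
by rewrite conj_genK -[RHS]mulrA conj_genK mulrA.
Qed.

Lemma conj_gen_near i j x : idist i j = 1%N ->
  conj_gen i (conj_gen j (conj_gen i x)) =
  conj_gen j (conj_gen i (conj_gen j x)).
Proof.
(* Right multiplication by g_i g_j g_i clears the inverses on one side and, after the braid
   relation, on the other. *)
move=> ij; apply/(@mulg_inj i)/(@mulg_inj j)/(@mulg_inj i).
have conj2 k l y : conj_gen k (conj_gen l y) * g k * g l = g k * g l * y.
  by rewrite conj_genK -[LHS]mulrA conj_genK mulrA.
have conj3 k l h y : conj_gen k (conj_gen l (conj_gen h y)) * g k * g l * g h =
    g k * g l * g h * y.
  by rewrite conj2 -[LHS]mulrA conj_genK mulrA.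
rewrite /= conj3; set y := conj_gen j _.
rewrite -!(mulrA y) (g_near ij) !(mulrA y).
exact/esym/conj3.
Qed.

(** The two expressions for e_i g_j e_i together say that g_j commutes with e_i e_j. *)
Lemma g_ee i j : idist i j = 1%N -> g j * (e i * e j) = e i * e j * g j.
Proof. by move=> ij; rewrite eeg // ege // mulrA. Qed.

(** By the quadratic relation g_i^2 is a combination of 1, e_i and e_i g_i with central
    coefficients; e_j commutes with e_i, and with e_i g_i by [g_ee]. *)
Lemma conj_gen_sq i j : idist i j = 1%N -> conj_gen i (conj_gen i (e j)) = e j.
Proof.
move=> ij; have ji : idist j i = 1%N by move: ij; rewrite /idist; lia.
have ge_i : g i * e i = e i * g i by apply: ge_far; rewrite /idist; lia.
have comm_eg : e i * g i * e j = e j * (e i * g i).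
  by rewrite -{1}ge_i -mulrA [e i * _]eC (g_ee ji) mulrA.
apply: conj_gen2E; rewrite -[RHS]mulrA g_sq -mulrA mulrBr mulr1.
apply/commr_sym/commrD; first exact: commr1.
apply: commrM; first exact/esym/r_central.
by apply: commrB; [exact: eC | exact/esym].
Qed.

Let conj_at k := conj_gen (inord k).
Let e_at k := e (inord k).

Definition tie_elt a b : B := tie conj_at e_at a b.

Lemma tie_elt_adj i a b : a != b ->
  conj_gen i (tie_elt a b) = tie_elt (adj_tperm i a) (adj_tperm i b).
Proof.
have val_in k : (k < m.+1)%N -> val (inord k : 'I_n.-1) = k.
  by move=> km; rewrite /= inordK.
have near k l : (k < m.+1)%N -> (l < m.+1)%N -> (k.+1 = l \/ l.+1 = k)%N ->
    idist (inord k : 'I_n.-1) (inord l) = 1%N.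
  by move=> km lm kl; rewrite /idist !val_in //; lia.
have far k l : (k < m.+1)%N -> (l < m.+1)%N -> (k.+1 < l \/ l.+1 < k)%N ->
    (1 < idist (inord k : 'I_n.-1) (inord l))%N.
  by move=> km lm kl; rewrite /idist !val_in //; lia.
move=> ab; rewrite /tie_elt !adj_tperm_val -[in LHS](inord_val i).
apply: (tie_adj (m := m.+1)) (ltn_ord i) (leq_ord a) (leq_ord b) ab.
- by move=> k _; apply: conj_gen_inj.
- by move=> k l x kl lm; apply: conj_gen_far; apply: far; lia.
- by move=> k x km; apply: conj_gen_near; apply: near; lia.
- by move=> k km; apply: conj_genE; apply: ge_far; rewrite /idist; lia.
- by move=> k l kl lm; split; apply: conj_genE; apply: ge_far;
    have := far k l; have := far l k; lia.
- by move=> k km; apply: conj_gen2E; apply: gge; apply: near; lia.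
- by move=> k km; split; apply: conj_gen_sq; apply: near; lia.
Qed.

Lemma tie_eltC a b : tie_elt a b = tie_elt b a.
Proof. exact: tieC. Qed.

Lemma tie_elt_simple i : tie_elt (adj_lo i) (adj_hi i) = e i.
Proof. by rewrite [LHS]tie_succ /e_at inord_val. Qed.

Lemma tie_elt_inord k : (k < m.+1)%N ->
  tie_elt (inord k) (inord k.+1) = e (inord k).
Proof.
move=> km; rewrite /tie_elt (inordK (leqW km)).
by rewrite (inordK (km : k.+1 < n)%N) tie_succ.
Qed.

Lemma conj_gen_comm i x y :
  GRing.comm x y -> GRing.comm (conj_gen i x) (conj_gen i y).
Proof. by move=> xy; rewrite /GRing.comm -!conj_genM xy. Qed.

Lemma inord_uniq s : (s <= n)%N ->
  uniq [seq (inord k : 'I_n) | k <- iota 0 s].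
Proof.
move=> sn; rewrite map_inj_in_uniq ?iota_uniq // => k l.
rewrite !mem_iota !add0n /= => ks ls /(congr1 val).
by rewrite /= !inordK // (leq_trans _ sn).
Qed.

Lemma size_uniq_ord (t : seq 'I_n) : uniq t -> (size t <= n)%N.
Proof. by move=> /card_uniqP <-; rewrite -[leqRHS]card_ord max_card. Qed.

(** This provides the orbit representatives: an injective tuple of points is a translate of (0, 1,
    ..., s-1). *)
Lemma inord_extend (t : seq 'I_n) : uniq t ->
  exists w : 'S_n, [seq w (inord k) | k <- iota 0 (size t)] = t.
Proof.
move=> Ut; have [|w wE] := perm_extend (inord_uniq (size_uniq_ord Ut)) Ut.
  by rewrite size_map size_iota.
by exists w; rewrite -[RHS]wE -map_comp.
Qed.

Lemma tie_elt_idem a b : a != b -> tie_elt a b * tie_elt a b = tie_elt a b.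
Proof.
move=> ab; have [|w [<- <-]] := @inord_extend [:: a; b].
  by rewrite /= inE ab.
have neq : inord 0 != inord 1 :> 'I_n.
  by have := inord_uniq (isT : 2 <= n)%N; rewrite /= inE andbT.
elim/adj_tperm_closed: w => [|w i IH]; first by rewrite !perm1 tie_elt_inord.
by rewrite !permM -tie_elt_adj ?(inj_eq perm_inj) // -conj_genM IH.
Qed.

Lemma tie_elt_perm_comm (w : 'S_n) a b c d : a != b -> c != d ->
  GRing.comm (tie_elt a b) (tie_elt c d) ->
  GRing.comm (tie_elt (w a) (w b)) (tie_elt (w c) (w d)).
Proof.
move=> ab cd H; elim/adj_tperm_closed: w => [|w i IH]; first by rewrite !perm1.
by rewrite !permM -!tie_elt_adj ?(inj_eq perm_inj) //; apply: conj_gen_comm.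
Qed.

(** Two distinct ties sharing a point can be moved to E_{0,1} and E_{1,2}, two disjoint ones to
    E_{0,1} and E_{2,3}. In both cases these are adjacent ties, which commute by [eC]. *)
Lemma tie_elt_comm a b c d : a != b -> c != d ->
  GRing.comm (tie_elt a b) (tie_elt c d).
Proof.
move=> ab cd.
have shared (p q s : 'I_n) : p != q -> q != s ->
    GRing.comm (tie_elt p q) (tie_elt q s).
  move=> pq qs; have [<-|ps] := eqVneq p s; first by rewrite tie_eltC.
  have Ut : uniq [:: p; q; s] by rewrite /= !inE negb_or pq ps qs.
  (* Three distinct points force n >= 3, so that 1 is a genuine generator index and [inord 1] is not
     a default value. *)
  have m3 := size_uniq_ord Ut.
  have [w [<- <- <-]] := inord_extend Ut.
  have := inord_uniq m3; rewrite /= !inE negb_or.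
  move=> /and3P[/andP[n01 n02] n12 _].
  by apply: tie_elt_perm_comm => //; rewrite !tie_elt_inord //; apply: eC.
have [Eac|ac] := eqVneq a c.
  rewrite -Eac in cd *; rewrite (tie_eltC a b).
  by apply: shared; rewrite // eq_sym.
have [Ead|ad] := eqVneq a d.
  rewrite -Ead (tie_eltC a b) (tie_eltC c a).
  by apply: shared; rewrite // eq_sym.
have [Ebc|bc] := eqVneq b c; first by rewrite -Ebc in cd *; apply: shared.
have [Ebd|bd] := eqVneq b d.
  by rewrite -Ebd (tie_eltC c b); apply: shared; rewrite // eq_sym.
have Ut : uniq [:: a; b; c; d] by rewrite /= !inE !negb_or ab ac ad bc bd cd.
have m4 := size_uniq_ord Ut.
have [w [<- <- <- <-]] := inord_extend Ut.
have := inord_uniq m4; rewrite /= !inE !negb_or.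
move=> /and4P[/and3P[n01 _ _] _ n23 _].
by apply: tie_elt_perm_comm => //; rewrite !tie_elt_inord //; apply: eC.
Qed.

Lemma tie_elt_trans a b c : a != b -> b != c -> a != c ->
  tie_elt a b * tie_elt b c * tie_elt a c = tie_elt a b * tie_elt b c.
Proof.
move=> ab bc ac.
have Ut : uniq [:: a; b; c] by rewrite /= !inE negb_or ab ac bc.
have m3 := size_uniq_ord Ut.
have [w [<- <- <-]] := inord_extend Ut.
have := inord_uniq m3; rewrite /= !inE negb_or => /and3P[/andP[n01 n02] n12 _].
elim/adj_tperm_closed: w => [|w i IH]; last first.
  by rewrite !permM -!tie_elt_adj ?(inj_eq perm_inj) // -!conj_genM IH.
rewrite !perm1.
have -> : tie_elt (inord 0) (inord 2) = conj_gen (inord 1) (e (inord 0)).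
  by rewrite -tie_elt_inord // /tie_elt !inordK // tieS.
rewrite !tie_elt_inord //.
have near01 : idist (inord 0 : 'I_n.-1) (inord 1) = 1%N.
  by rewrite /idist /= !inordK.
have eee i j : e i * e j * e i = e i * e j by rewrite eC -mulrA ee.
(* As g_1 commutes with e_0 e_1, one gets e_0 e_1 g_1 e_0 g_1^-1 = g_1 e_0 e_1 e_0 g_1^-1 = g_1 e_0
   e_1 g_1^-1 = e_0 e_1. *)
by rewrite /conj_gen !mulrA -g_ee // -(mulrA (g _)) eee g_ee // -mulrA gV mulr1.
Qed.

Lemma g_tie_prod i (P : root_subsystem n) :
  g i * tie_prod tie_elt P =
  tie_prod tie_elt (perm_subsystem (adj_tperm i) P) * g i.
Proof.
apply: (tie_prod_perm tie_elt_idem tie_elt_comm _ (Vg i) (gV i)) => a b ab.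
rewrite -conj_genK tie_elt_adj ?(inj_eq perm_inj) //.
by rewrite -!permM adj_tpermK !perm1.
Qed.

Lemma tie_elt_prod_simple i : tie_prod tie_elt (simple_subsystem i) = e i.
Proof.
rewrite tie_prod_simple ?tie_elt_simple //.
- exact: tie_eltC.
- exact: tie_elt_idem.
- exact: tie_elt_comm.
Qed.

Lemma tie_elt_prodM (P Q : root_subsystem n) :
  tie_prod tie_elt (P * Q)%g = tie_prod tie_elt P * tie_prod tie_elt Q.
Proof.
apply: tie_prodM.
- exact: tie_eltC.
- exact: tie_elt_idem.
- exact: tie_elt_comm.
- exact: tie_elt_trans.
Qed.

End TieRelations.

(** * Multiplicative maps out of the braid group *)

Section BraidLift.
Variables (n : nat) (B : pzRingType) (g g' : 'I_n.-1 -> B).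
Implicit Types (i j : 'I_n.-1) (b : braid_group n).

Hypothesis gV : forall i, g i * g' i = 1.
Hypothesis Vg : forall i, g' i * g i = 1.
Hypothesis g_far : forall i j, (1 < idist i j)%N -> g i * g j = g j * g i.
Hypothesis g_near : forall i j, idist i j = 1%N ->
  g i * g j * g i = g j * g i * g j.

Definition word_lift (w : braid_word n) : B :=
  \prod_(x <- w) if x.2 then g x.1 else g' x.1.

Definition braid_lift b : B := word_lift (repr b).

Lemma word_lift_cat v w : word_lift (v ++ w) = word_lift v * word_lift w.
Proof. exact: big_cat. Qed.

Lemma word_lift_eq (v w : braid_word n) :
  braid_eq v w -> word_lift v = word_lift w.
Proof.
elim=> {v w} //.
- by move=> v w x _ -> _ ->.
- by move=> v v' w w' _ IHv _ IHw; rewrite !word_lift_cat IHv IHw.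
- move=> i b; rewrite /word_lift !big_cons !big_nil mulr1.
  by case: b; rewrite /= ?gV ?Vg.
- by move=> i j ij; rewrite /word_lift !big_cons !big_nil /= !mulr1 g_far.
- move=> i j ij; rewrite /word_lift !big_cons !big_nil /= !mulr1 !mulrA.
  exact: g_near.
Qed.

Lemma braid_liftE w : braid_lift (braid_of w) = word_lift w.
Proof. exact/word_lift_eq/repr_braid_of. Qed.

Lemma braid_lift1 : braid_lift 1%g = 1.
Proof. by rewrite braid_liftE /word_lift big_nil. Qed.

Lemma braid_liftM b c : braid_lift (b * c)%g = braid_lift b * braid_lift c.
Proof.
elim/braid_ind: b => v; elim/braid_ind: c => w.
by rewrite [(_ * _)%g]braid_mulE !braid_liftE word_lift_cat.
Qed.

Lemma braid_lift_gen i : braid_lift (braid_gen i) = g i.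
Proof. by rewrite braid_liftE /word_lift big_seq1. Qed.

End BraidLift.

Lemma braid_gen_ind (n : nat) (K : braid_group n -> Prop) :
  K 1%g -> (forall a b, K a -> K b -> K (a * b)%g) ->
  (forall i, K (braid_gen i)) -> (forall i, K (braid_gen i)^-1%g) ->
  forall b, K b.
Proof.
move=> K1 KM Kg Kg'; elim/braid_ind; elim=> // -[i c] w IHw.
suff Kc : K (braid_of [:: (i, c)]).
  by have := KM _ _ Kc IHw; rewrite [(_ * _)%g]braid_mulE.
case: c; first exact: Kg.
rewrite (_ : braid_of [:: (i, false)] = (braid_gen i)^-1)%g //.
(* A letter marked [false] and the group inverse are both right inverses of the generator. *)
apply: (mulgI (braid_gen i)); rewrite mulgV [LHS]braid_mulE.
exact/braid_ofP/(braid_eq_cancel i true).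
Qed.

(** * Relations in the algebra of braids and ties, and inverses of generators *)

Section BraidsAndTiesRelations.
Variables (n : nat) (R : comPzRingType) (u : R).
Local Notation g := (@bt_g n R u).
Local Notation e := (@bt_e n R u).
Implicit Types i j : 'I_n.-1.

Lemma bt_gg_far_eq i j : (1 < idist i j)%N -> g i * g j = g j * g i.
Proof. by move=> /(bt_gg_far u)/to_quot_relator; rewrite !to_quotM. Qed.

Lemma bt_ggg_eq i j : idist i j = 1%N -> g i * g j * g i = g j * g i * g j.
Proof. by move=> /(bt_ggg u)/to_quot_relator; rewrite !to_quotM. Qed.

Lemma bt_quadratic_eq i : g i * g i = 1 + rscalar (u - 1) * e i * (1 - g i).
Proof.
have := to_quot_relator (bt_quadratic u i).
by rewrite expr2 to_quotD !to_quotM to_quotB.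
Qed.

Lemma bt_ge_eq i j : idist i j != 1%N -> g i * e j = e j * g i.
Proof. by move=> /(bt_ge u)/to_quot_relator; rewrite !to_quotM. Qed.

Lemma bt_gge_eq i j : idist i j = 1%N -> g j * g i * e j = e i * g j * g i.
Proof. by move=> /(bt_gge u)/to_quot_relator; rewrite !to_quotM. Qed.

Lemma bt_ee_eq i j : e i * e j = e j * e i.
Proof. by have := to_quot_relator (bt_ee u i j); rewrite !to_quotM. Qed.

Lemma bt_idem_eq i : e i * e i = e i.
Proof. by have := to_quot_relator (bt_idem u i); rewrite expr2 to_quotM. Qed.

Lemma bt_eeg_eq i j : idist i j = 1%N -> e i * e j * g j = e i * g j * e i.
Proof. by move=> /(bt_eeg u)/to_quot_relator; rewrite !to_quotM. Qed.

Lemma bt_ege_eq i j : idist i j = 1%N -> e i * g j * e i = g j * e i * e j.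
Proof. by move=> /(bt_ege u)/to_quot_relator; rewrite !to_quotM. Qed.

End BraidsAndTiesRelations.

(** The condition on s and t reads (1 + t)(1 + s) = 1; it is applied with 1 + s = u and 1 + t =
    u^-1. *)
Lemma quadratic_inverse (B : pzRingType) (g e s t : B) :
  (forall x, s * x = x * s) -> (forall x, t * x = x * t) ->
  g * e = e * g -> e * e = e -> g * g = 1 + s * e * (1 - g) ->
  s + t + t * s = 0 ->
  exists g', g * g' = 1 /\ g' * g = 1.
Proof.
move=> sC tC ge ee gg st; pose y := e * (1 - g).
have {gg} gg : g * g = 1 + s * y by rewrite mulrA.
have yg : y * g = g * y.
  rewrite /y [in RHS]mulrA ge -!mulrA; congr (e * _).
  by rewrite mulrBl mulrBr mul1r mulr1.
have ey : e * y = y by rewrite /y mulrA ee.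
have gy : g * y = - (y + s * y).
  have E : g * (1 - g) = - ((1 - g) + s * y).
    by rewrite mulrBr mulr1 gg !opprD opprK addrA [g - 1]addrC.
  by rewrite /y mulrA ge -mulrA E mulrN mulrDr mulrA -sC -mulrA ey.
clearbody y; have ty : t * y * g = g * (t * y) by rewrite mulrA -tC -!mulrA yg.
have inv : g * (g - t * y) = 1.
  (* With y = e (1 - g) one has g y = -(1 + s) y, hence g (g - t y) = 1 + (s + t + t s) y = 1. *)
  rewrite mulrBr gg mulrA -tC -mulrA gy mulrN opprK mulrDr (mulrA t s) -mulrDl.
  by rewrite -addrA -mulrDl addrA st mul0r addr0.
by exists (g - t * y); split; rewrite // mulrBl ty -mulrBr.
Qed.

(** * The homomorphism out of the Marin ring *)

Section MarinLift.
Variables (m : nat) (R : comPzRingType) (u : R).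
Variable u_unit : exists v, v * u = 1.
Local Notation n := m.+2.
Variables (B : pzAlgebraType R) (g e : 'I_n.-1 -> B).
Implicit Types (i j : 'I_n.-1) (P : root_subsystem n).

Hypothesis g_far : forall i j, (1 < idist i j)%N -> g i * g j = g j * g i.
Hypothesis g_near : forall i j, idist i j = 1%N ->
  g i * g j * g i = g j * g i * g j.
Hypothesis g_sq : forall i, g i * g i = 1 + rscalar (u - 1) * e i * (1 - g i).
Hypothesis ge_far : forall i j, idist i j != 1%N -> g i * e j = e j * g i.
Hypothesis gge : forall i j, idist i j = 1%N ->
  g j * g i * e j = e i * g j * g i.
Hypothesis eC : forall i j, e i * e j = e j * e i.
Hypothesis ee : forall i, e i * e i = e i.
Hypothesis eeg : forall i j, idist i j = 1%N ->
  e i * e j * g j = e i * g j * e i.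
Hypothesis ege : forall i j, idist i j = 1%N ->
  e i * g j * e i = g j * e i * e j.

Lemma g_invertible : exists g' : 'I_n.-1 -> B,
  (forall i, g i * g' i = 1) /\ (forall i, g' i * g i = 1).
Proof.
have [v vu] := u_unit.
suff /choice[g' gg'] : forall i, exists y, g i * y = 1 /\ y * g i = 1.
  by exists g'; split=> i; case: (gg' i).
move=> i; pose s : B := rscalar (u - 1); pose t : B := rscalar (v - 1).
apply: (@quadratic_inverse _ _ (e i) s t) => //.
- exact: rscalar_central.
- exact: rscalar_central.
- by apply: ge_far; rewrite /idist subrr.
- rewrite -rmorphM -!rmorphD [X in rscalar X](_ : _ = 0) ?rmorph0 //.
  by ring: vu.
Qed.

Local Notation sigma := (@simple_subsystem n).
Local Notation act := (sigma_action sigma R).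
Local Notation hat := (hat_e n u_unit).

(** On the monoid basis the map is the product of ties. The intertwining relation with g_i is stable
    under sums and products of coefficients, so only scalars and monoid elements remain to be
    checked. *)
Lemma sigma_lift : exists phi : {rmorphism sigma_alg sigma R -> B},
  [/\ alg_morphism phi, forall i, phi (sigma_e sigma R i) = e i &
    forall i c, g i * phi c = phi (act (adj_tperm i) c) * g i].
Proof.
have [g' [gV Vg]] := g_invertible.
have r_central x : rscalar (u - 1) * x = x * rscalar (u - 1) :> B.
  exact: rscalar_central.
pose tp P := tie_prod (tie_elt g g' e) P.
have [||phi [phiR phiE]] := @monoid_alg_lift R (gen_subsystems sigma) B
    (fun P : gen_subsystems sigma => tp (val P)).
- exact: tie_prod1.
- by move=> P Q; apply: (tie_elt_prodM gV Vg g_far g_near r_central g_sq).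
pose phi' : {rmorphism sigma_alg sigma R -> B} := phi.
exists phi'; split=> //.
  move=> i; rewrite [LHS]phiE.
  exact: (tie_elt_prod_simple gV Vg g_far g_near r_central g_sq).
move=> i; apply: monoid_alg_ind => [c d IHc IHd|c d IHc IHd|r|P].
- by rewrite !rmorphD mulrDl mulrDr IHc IHd.
- by rewrite !rmorphM mulrA IHc -!mulrA IHd.
- by rewrite [act _ _]alg_act_scalar !phiR rscalar_central.
rewrite [act _ _]lin_ext_term [phi' _]phiE [phi' _ in RHS]phiE.
exact: (g_tie_prod gV Vg g_far g_near r_central g_sq).
Qed.

Lemma marin_lift : exists F : {rmorphism marin_ring hat -> B},
  [/\ alg_morphism F, forall i, F (marin_g hat i) = g i &
    forall i, F (marin_coef hat (sigma_e sigma R i)) = e i].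
Proof.
have [phi [phiR phi_e phi_g]] := sigma_lift.
have [g' [gV Vg]] := g_invertible.
pose h := braid_lift g g'.
have h1 : h 1%g = 1 by apply: braid_lift1.
have hM k l : h (k * l)%g = h k * h l by apply: braid_liftM.
have hg i : h (braid_gen i) = g i by apply: braid_lift_gen.
pose bact := braid_action act.
have h_act k c : h k * phi c = phi (bact k c) * h k.
  have gen i d : h (braid_gen i) * phi d =
      phi (bact (braid_gen i) d) * h (braid_gen i).
    by rewrite hg phi_g; congr (phi (act _ _) * _); rewrite braid_perm_gen.
  elim/braid_gen_ind: k c => [|k l IHk IHl|i|i] c.
  - by rewrite h1 mulr1 mul1r alg_act1.
  - by rewrite hM -mulrA IHl mulrA IHk -mulrA alg_actM.
  - exact: gen.
  set k := braid_gen i.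
  have kV : h k * h k^-1%g = 1 by rewrite -hM mulgV h1.
  have Vk : h k^-1%g * h k = 1 by rewrite -hM mulVg h1.
  (* For an inverse generator, write c = k.(k^-1.c) and apply the case of k to k^-1.c, then
     cancel. *)
  rewrite -[phi c in LHS]mulr1 -kV -{1}(alg_act1 bact c) -(mulgV k) alg_actM.
  by rewrite [_ * (h k * _)]mulrA -gen !mulrA Vk mul1r.
have [psi psiE] := skew_lift h1 hM h_act.
have psi_coef c : psi (skew_coef bact c) = phi c by rewrite [LHS]psiE h1 mulr1.
have psi_elt k : psi (skew_elt bact k) = h k.
  by rewrite [LHS]psiE rmorph1 mul1r.
have [|F FE] := @quot_lift _ _ B (@marin_relator _ _ _ _ hat) psi.
  (* With z = (u - 1) e_i the parameter is 1 + z, so the relator maps to g_i^2 - (1 + z) + z g_i,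
     which vanishes by the quadratic relation. *)
  move=> _ [i ->]; rewrite expr2 !(rmorphB psi) !(rmorphM psi) (rmorphB psi).
  rewrite (rmorph1 psi) !psi_coef !psi_elt hg g_sq.
  have -> : phi (hat i) = 1 + rscalar (u - 1) * e i.
    by rewrite [LHS](rmorphD phi) (rmorph1 phi) (rmorphM phi) phiR phi_e.
  set z := _ * e i.
  have -> : 1 - (1 + z) = - z by rewrite opprD addrA subrr sub0r.
  rewrite mulNr opprK mulrBr mulr1 [1 + (z - _)]addrA.
  by rewrite (addrAC _ (- (1 + z))) subrK subrr.
exists F; split.
- by move=> r; rewrite [LHS]FE [LHS]psi_coef phiR.
- by move=> i; rewrite [LHS]FE psi_elt hg.
- by move=> i; rewrite [LHS]FE psi_coef phi_e.
Qed.

End MarinLift.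

(** * The isomorphism *)

Section BraidsAndTiesLift.
Variables (n : nat) (R : comPzRingType) (u : R).
Variables (B : pzAlgebraType R) (g e : 'I_n.-1 -> B).
Implicit Types i j : 'I_n.-1.

Hypothesis g_far : forall i j, (1 < idist i j)%N -> g i * g j = g j * g i.
Hypothesis g_near : forall i j, idist i j = 1%N ->
  g i * g j * g i = g j * g i * g j.
Hypothesis g_sq : forall i, g i * g i = 1 + rscalar (u - 1) * e i * (1 - g i).
Hypothesis ge_far : forall i j, idist i j != 1%N -> g i * e j = e j * g i.
Hypothesis gge : forall i j, idist i j = 1%N ->
  g j * g i * e j = e i * g j * g i.
Hypothesis eC : forall i j, e i * e j = e j * e i.
Hypothesis ee : forall i, e i * e i = e i.
Hypothesis eeg : forall i j, idist i j = 1%N ->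
  e i * e j * g j = e i * g j * e i.
Hypothesis ege : forall i j, idist i j = 1%N ->
  e i * g j * e i = g j * e i * e j.

Lemma bt_lift : exists F : {rmorphism bt_algebra n u -> B},
  [/\ alg_morphism F, forall i, F (bt_g u i) = g i &
    forall i, F (bt_e u i) = e i].
Proof.
pose h (x : 'I_n.-1 + 'I_n.-1) := match x with inl i => g i | inr i => e i end.
have [psi [psiR psiE]] := free_alg_lift h.
have psi_g i : psi (free_gen R (inl i)) = g i by apply: psiE.
have psi_e i : psi (free_gen R (inr i)) = e i by apply: psiE.
have [|F FE] := @quot_lift _ _ B (@bt_relator n R u) psi.
  have sub0 x y : psi x = psi y -> psi (x - y) = 0.
    by rewrite (rmorphB psi) => ->; rewrite subrr.
  move=> _ [i j ij|i j ij|i|i j ij|i j ij|i j|i|i j ij|i j ij]; apply: sub0;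
    rewrite ?expr2 ?(rmorphD psi) ?(rmorphM psi) ?(rmorphM psi) ?(rmorphB psi)
      ?(rmorph1 psi) ?psi_g ?psi_e ?psiR.
  - exact: g_far.
  - exact: g_near.
  - exact: g_sq.
  - exact: ge_far.
  - exact: gge.
  - exact: eC.
  - exact: ee.
  - exact: eeg.
  - exact: ege.
exists F; split.
- by move=> r; rewrite [LHS]FE psiR.
- by move=> i; rewrite [LHS]FE psi_g.
- by move=> i; rewrite [LHS]FE psi_e.
Qed.

End BraidsAndTiesLift.

(** * The relations of braids and ties in the Marin ring, and its generators *)

Section MarinRelations.
Variables (n : nat) (R : comPzRingType) (u : R).
Variable u_unit : exists v, v * u = 1.
Local Notation sigma := (@simple_subsystem n).
Local Notation act := (sigma_action sigma R).
Local Notation hat := (hat_e n u_unit).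
Local Notation g := (marin_g hat).
Local Notation c := (marin_coef hat).
Local Notation e := (sigma_e sigma R).
Local Notation s := (@adj_tperm n).
Implicit Types (i j : 'I_n.-1) (w : 'S_n) (x y : sigma_alg sigma R).

Definition marin_braid (b : braid_group n) : marin_ring hat :=
  to_quot (@marin_relator _ _ _ _ hat) (skew_elt (braid_action act) b).

Lemma marin_coefM x y : c (x * y) = c x * c y.
Proof. by rewrite -to_quotM -rmorphM. Qed.

Lemma marin_coefD x y : c (x + y) = c x + c y.
Proof. by rewrite -to_quotD -rmorphD. Qed.

Lemma marin_braidM a b : marin_braid (a * b)%g = marin_braid a * marin_braid b.
Proof. by rewrite -to_quotM skew_termM rmorph1 mulr1. Qed.

Lemma marin_braidV b : marin_braid b * marin_braid b^-1%g = 1.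
Proof. by rewrite -marin_braidM mulgV. Qed.

Lemma marin_braid_coef b x :
  marin_braid b * c x = c (act (braid_perm b) x) * marin_braid b.
Proof. by rewrite -!to_quotM skew_commute. Qed.

Lemma marin_gc i x : g i * c x = c (act (s i) x) * g i.
Proof. by rewrite [LHS]marin_braid_coef braid_perm_gen. Qed.

Lemma sigma_act_e w i j : (w * s i * w^-1 = s j)%g -> act w (e i) = e j.
Proof.
move=> wij; rewrite [LHS]lin_ext_term; congr skew_term.
exact/val_inj/perm_simple_subsystem.
Qed.

Lemma adj_conj_far i j : idist i j != 1%N -> (s i * s j * (s i)^-1 = s j)%g.
Proof.
move=> ij; suff -> : (s i * s j = s j * s i)%g by rewrite mulgK.
(* A distance other than 1 is either 0, where i = j, or at least 2, where the transpositions
   commute. *)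
have [ij0|ij1] := posnP (idist i j).
  suff -> : i = j by [].
  by apply: val_inj => /=; move: ij0; rewrite /idist; lia.
by apply: adj_tperm_far; rewrite ltn_neqAle eq_sym ij.
Qed.

Lemma adj_conj_near i j : idist i j = 1%N ->
  (s j * s i * s j * (s j * s i)^-1 = s i)%g.
Proof. by move=> ij; rewrite -(adj_tperm_near ij) -(mulgA (s i)) mulgK. Qed.

Lemma marin_far i j : (1 < idist i j)%N -> g i * g j = g j * g i.
Proof.
move=> ij; rewrite -!marin_braidM; congr marin_braid.
by rewrite ![(_ * _)%g]braid_mulE; apply/braid_ofP/braid_eq_far.
Qed.

Lemma marin_near i j : idist i j = 1%N -> g i * g j * g i = g j * g i * g j.
Proof.
have braid3 k l : (braid_gen k * braid_gen l * braid_gen k)%g =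
    braid_of [:: (k, true); (l, true); (k, true)].
  by rewrite [(_ k * _ l)%g]braid_mulE [LHS]braid_mulE.
move=> ij; rewrite -!marin_braidM !braid3; congr marin_braid.
exact/braid_ofP/braid_eq_near.
Qed.

Lemma marin_sq i : g i * g i = 1 + rscalar (u - 1) * c (e i) * (1 - g i).
Proof.
set z := _ * c _; have cE : c (hat i) = 1 + z.
  by rewrite marin_coefD marin_coefM.
pose gi := skew_elt (braid_action act) (braid_gen i).
pose ai := skew_coef (braid_action act) (hat i).
have /to_quot_relator : marin_relator hat (gi ^+ 2 - ai - (1 - ai) * gi).
  by exists i.
rewrite expr2 to_quotB !to_quotM to_quotB to_quot1 -/(g i) -/(c (hat i)).
move/(canRL (subrK _)) ->; rewrite cE.
have -> : 1 - (1 + z) = - z by rewrite opprD addrA subrr sub0r.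
by rewrite mulNr mulrBr mulr1 addrC -addrA.
Qed.

Lemma marin_ge i j : idist i j != 1%N -> g i * c (e j) = c (e j) * g i.
Proof. by move=> ij; rewrite marin_gc (sigma_act_e (adj_conj_far ij)). Qed.

Lemma marin_gge i j : idist i j = 1%N ->
  g j * g i * c (e j) = c (e i) * g j * g i.
Proof.
move=> ij; rewrite -mulrA marin_gc mulrA marin_gc -alg_actM.
by rewrite (sigma_act_e (adj_conj_near ij)).
Qed.

Lemma marin_eC i j : c (e i) * c (e j) = c (e j) * c (e i).
Proof. by rewrite -!marin_coefM mulrC. Qed.

Lemma marin_ee i : c (e i) * c (e i) = c (e i).
Proof. by rewrite -marin_coefM sigma_e_idem. Qed.

Lemma simple_subsystem_reflect i (P T : root_subsystem n) :
  ((sigma i : set _) `<=` T)%classic -> (P `<=` T)%classic ->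
  (perm_subsystem (s i) P `<=` T)%classic.
Proof.
move=> iT PT _ [a /PT Ta <-]; rewrite -simple_reflection.
by apply: (root_subsystemP T).2 => //; apply: iT; left.
Qed.

(** A root subsystem containing alpha_i is stable under s_i, so it contains P exactly when it
    contains s_i P. *)
Lemma simple_mul_reflect i (P : root_subsystem n) :
  (sigma i * perm_subsystem (s i) P = sigma i * P)%g.
Proof.
apply: subsystem_eqP => T; rewrite !subsystem_mulP.
split=> -[iT PT]; split=> //; last exact: simple_subsystem_reflect.
rewrite -[P]perm_subsystem1 -(adj_tpermK i) perm_subsystemM.
exact: simple_subsystem_reflect.
Qed.

Lemma sigma_e_reflect i j : e i * act (s i) (e j) = e i * e j.
Proof.
rewrite [act _ _]lin_ext_term ![LHS]skew_termM [RHS]skew_termM.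
by congr skew_term; apply/val_inj/simple_mul_reflect.
Qed.

(** Both sides come from the subsystem of the root alpha_i + alpha_j, which is s_i alpha_j as well
    as s_j alpha_i. *)
Lemma sigma_e_near i j : idist i j = 1%N -> act (s i) (e j) = act (s j) (e i).
Proof.
move=> ij; rewrite -(sigma_act_e (adj_conj_near ij)) -alg_actM.
by rewrite mulgA adj_tpermK mul1g.
Qed.

Lemma marin_eeg i j : idist i j = 1%N ->
  c (e i) * c (e j) * g j = c (e i) * g j * c (e i).
Proof.
move=> ij; rewrite -[RHS]mulrA marin_gc mulrA -!marin_coefM.
by rewrite -sigma_e_near // sigma_e_reflect.
Qed.

Lemma marin_ege i j : idist i j = 1%N ->
  c (e i) * g j * c (e i) = g j * c (e i) * c (e j).
Proof.
move=> ij; rewrite -marin_eeg // -[RHS]mulrA -marin_coefM marin_gc.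
rewrite rmorphM (sigma_act_e (adj_conj_far (j := j) _)) ?/idist ?subrr //.
by rewrite [in RHS]mulrC sigma_e_reflect mulrC.
Qed.

Lemma gen_subsystem_ind (K : gen_subsystems sigma -> Prop) :
  K 1%g -> (forall w i, K (perm_gen_subsystem w (gen_subsystem_of sigma i))) ->
  (forall P Q, K P -> K Q -> K (P * Q)%g) -> forall P, K P.
Proof.
move=> K1 Kw KM P.
suff: forall T, gen_by_orbits sigma T ->
    forall Q : gen_subsystems sigma, val Q = T -> K Q.
  by apply; first exact: gen_subsystemP.
move=> {P} T; elim=> {T} [P EP|w i P EP|P Q HP IHP HQ IHQ T ET].
- by rewrite (_ : P = 1%g) //; apply: val_inj.
- by rewrite (_ : P = perm_gen_subsystem w (gen_subsystem_of sigma i)) //;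
    apply: val_inj.
- rewrite (_ : T = mk_gen_subsystem HP * mk_gen_subsystem HQ)%g.
    by apply: KM; [apply: IHP | apply: IHQ].
  exact: val_inj.
Qed.

Lemma braid_perm_surj w : exists b : braid_group n, braid_perm b = w.
Proof.
by have [v <-] := word_perm_surj w; exists (braid_of v); rewrite braid_permE.
Qed.

(** The Marin ring is generated over R by the g_i, their inverses and the e_i. Inverses enter as a
    closure condition on [K], which the fixed points of a ring endomorphism satisfy
    automatically. *)
Lemma marin_ind (K : marin_ring hat -> Prop) :
  (forall x y : marin_ring hat, K x -> K y -> K (x + y)) ->
  (forall x y : marin_ring hat, K x -> K y -> K (x * y)) ->
  (forall r, K (rscalar r)) -> (forall i, K (g i)) ->
  (forall x y : marin_ring hat, K x -> x * y = 1 -> y * x = 1 -> K y) ->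
  (forall i, K (c (e i))) -> forall x : marin_ring hat, K x.
Proof.
move=> KD KM KR Kg KV Ke.
have K1 : K 1 by rewrite -(rmorph1 (rscalar : {rmorphism R -> marin_ring hat})).
have Kb b : K (marin_braid b).
  elim/braid_gen_ind: b => [|a b Ka Kb|i|i]; first exact: K1.
  - by rewrite marin_braidM; apply: KM.
  - exact: Kg.
  apply: (KV _ _ (Kg i)); first exact: marin_braidV.
  by rewrite -[X in _ * X]/(marin_braid _) -marin_braidM mulVg.
have Kc x : K (c x).
  elim/monoid_alg_ind: x => [x y Kx Ky|x y Kx Ky|r|].
  - by rewrite marin_coefD; apply: KD.
  - by rewrite marin_coefM; apply: KM.
  - exact: KR.
  elim/gen_subsystem_ind => [|w i|P Q KP KQ]; first exact: K1.
    have [b bw] := braid_perm_surj w.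
    pose P := perm_gen_subsystem w (gen_subsystem_of sigma i).
    (* A translated generator w.e_i is the conjugate of e_i by any braid lying over w. *)
    suff -> : c (monoid_gen R P) =
        marin_braid b * c (e i) * marin_braid b^-1%g.
      by apply: (KM _ _ _ (Kb _)); apply: KM.
    rewrite marin_braid_coef bw -mulrA marin_braidV mulr1; congr c.
    exact/esym/lin_ext_term.
  rewrite (_ : monoid_gen R (P * Q)%g = monoid_gen R P * monoid_gen R Q).
    by rewrite marin_coefM; apply: KM.
  by rewrite [RHS]skew_termM rmorph1 mulr1.
elim/quot_ind => x; elim/skew_ind: x => [|x y Kx Ky|x b].
- by have := KR 0; rewrite rmorph0.
- by rewrite to_quotD; apply: KD.
- by rewrite skew_termZ to_quotM; apply: KM; [exact: Kc | exact: Kb].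
Qed.

End MarinRelations.

Lemma bt_ind (n : nat) (R : comPzRingType) (u : R)
    (K : bt_algebra n u -> Prop) :
  (forall x y, K x -> K y -> K (x + y)) ->
  (forall x y, K x -> K y -> K (x * y)) ->
  (forall r, K (rscalar r)) -> (forall i, K (bt_g u i)) ->
  (forall i, K (bt_e u i)) -> forall x, K x.
Proof.
move=> KD KM KR Kg Ke; elim/quot_ind.
elim/free_alg_ind => [x y Kx Ky|x y Kx Ky|r|[i|i]].
- by rewrite to_quotD; apply: KD.
- by rewrite to_quotM; apply: KM.
- exact: KR.
- exact: Kg.
- exact: Ke.
Qed.

Theorem proposition4p4 (n : nat) (n_ge2 : (2 <= n)%N)
    (R : comPzRingType) (u : R) (u_unit : exists v : R, v * u = 1) :
  exists f : {rmorphism marin_ring (hat_e n u_unit) -> bt_algebra n u},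
    [/\ alg_morphism f,
        bijective f,
        (forall i : 'I_n.-1, f (marin_g (hat_e n u_unit) i) = bt_g u i) &
        (forall i : 'I_n.-1,
           f (marin_coef (hat_e n u_unit) (sigma_e (@simple_subsystem n) R i))
           = bt_e u i)].
Proof.
case: n n_ge2 => [|[|m]] // _.
have [f [fR fg fe]] := @marin_lift m R u u_unit _ _ _
  (@bt_gg_far_eq _ _ u) (@bt_ggg_eq _ _ u) (@bt_quadratic_eq _ _ u)
  (@bt_ge_eq _ _ u) (@bt_gge_eq _ _ u) (@bt_ee_eq _ _ u) (@bt_idem_eq _ _ u)
  (@bt_eeg_eq _ _ u) (@bt_ege_eq _ _ u).
have [h [hR hg he]] := @bt_lift m.+2 R u _ _ _
  (@marin_far _ _ _ u_unit) (@marin_near _ _ _ u_unit) (@marin_sq _ _ _ u_unit)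
  (@marin_ge _ _ _ u_unit) (@marin_gge _ _ _ u_unit) (@marin_eC _ _ _ u_unit)
  (@marin_ee _ _ _ u_unit) (@marin_eeg _ _ _ u_unit) (@marin_ege _ _ _ u_unit).
exists f; split=> //; exists h.
  apply: marin_ind => [x y hx hy|x y hx hy|r|i|x y hx xy yx|i].
  - by rewrite (rmorphD f) (rmorphD h) hx hy.
  - by rewrite (rmorphM f) (rmorphM h) hx hy.
  - by rewrite fR hR.
  - by rewrite fg hg.
  (* An endomorphism fixing x fixes its inverse y: h (f y) = h (f y) x y = h (f (y x)) y = y. *)
  - rewrite -[LHS]mulr1 -xy -{1}hx mulrA -(rmorphM h) -(rmorphM f) yx.
    by rewrite (rmorph1 f) (rmorph1 h) mul1r.
  - by rewrite fe he.
apply: bt_ind => [x y hx hy|x y hx hy|r|i|i].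
- by rewrite (rmorphD h) (rmorphD f) hx hy.
- by rewrite (rmorphM h) (rmorphM f) hx hy.
- by rewrite hR fR.
- by rewrite hg fg.
- by rewrite he fe.
Qed.
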